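(* Let $\alpha\colon S\curvearrowright A$ be an action of an inverse semigroup $S$ on a C*-algebra $A$, and let $\beta\colon S\curvearrowright\hat A$ be the induced action of $S$ on the spectrum $\hat A$ of $A$. Let $\pi\colon A\to B(H_\pi)$ be an irreducible representation. For $a\in A$, $s\in S$, $\xi\in\ell^2(G_\pi,H_\pi)$ and $[t,\pi]\in G_\pi$, define $\rho_\pi\colon A\to B(\ell^2(G_\pi,H_\pi))$ and $\sigma_\pi\colon S\to B(\ell^2(G_\pi,H_\pi))$ by $$(\rho_\pi(a)\xi)([t,\pi])=\beta_t(\pi)(a)\big(\xi([t,\pi])\big),\qquad (\sigma_\pi(s)\xi)([t,\pi])=\begin{cases}\xi([s^*t,\pi])&\text{if }\beta_t(\pi)\in\hat A_{ss^*}\\0&\text{otherwise.}\end{cases}$$ Then $(\rho_\pi,\sigma_\pi)$ is a covariant representation of $\alpha\colon S\curvearrowright A$.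
   Context: Ideals of C*-algebras are closed and two-sided. An inverse semigroup is a semigroup $S$ in which every $s$ has a unique inverse $s^*$ with $ss^*s=s$ and $s^*ss^*=s^*$; $E(S)$ is the set of idempotents. $\mathcal I(X)$ is the inverse semigroup of partial bijections of a set $X$ (bijections between subsets of $X$, composed wherever the composition makes sense). An action $\alpha\colon S\curvearrowright A$ on a C*-algebra $A$ is a homomorphism $\alpha\colon S\to\mathcal I(A)$ such that each $\alpha_s$ is a C*-isomorphism whose domain $A_{s^*s}$ is an ideal of $A$ (so $\alpha_s\colon A_{s^*s}\to A_{ss^*}$), and the linear span of $\{A_{s^*s}:s\in S\}$ is dense in $A$. For $e\in E(S)$, $A_e$ is the domain of $\alpha_e$. $\hat A$ is the spectrum of $A$; the same symbol denotes an irreducible representation and its class. For an ideal $I$ of $A$, $\hat I$ is identified with the open subset $\{\pi\in\hat A:\pi|_I\neq0\}$ of $\hat A$. The induced action $\beta$ is given by the homeomorphisms $\beta_s\colon \hat A_{s^*s}\to\hat A_{ss^*}$, $\beta_s(\pi)=\overline{\pi\circ\alpha_{s^*}}$, where $\overline{\pi\circ\alpha_{s^*}}\colon A\to B(H_\pi)$ is the unique extension to $A$ of the irreducible representation $\pi\circ\alpha_{s^*}$ of the ideal $A_{ss^*}$ on $H_\pi$. Germs: on $\Omega=\{(s,\pi):s\in S,\ \pi\in\hat A_{s^*s}\}$ put $(s,\pi)\sim(t,\eta)$ iff $\pi=\eta$ and there is $e\in E(S)$ with $\pi\in\hat A_e$ and $se=te$; $[s,\pi]$ is the class of $(s,\pi)$.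 For $\pi\in\hat A$, $G_\pi=\{[t,\pi]:t\in S,\ \pi\in\hat A_{t^*t}\}$ (a discrete set), and $\ell^2(G_\pi,H_\pi)$ is the Hilbert space of square-summable functions $G_\pi\to H_\pi$. A covariant representation of $\alpha\colon S\curvearrowright A$ on a Hilbert space $H$ is a pair $(\rho,\sigma)$ with $\rho\colon A\to B(H)$ a non-degenerate representation and $\sigma\colon S\to B(H)$ a map such that for all $s,t\in S$, $e\in E(S)$: (1) $\sigma_{st}=\sigma_s\sigma_t$ and $\sigma_{s^*}=\sigma_s^*$; (2) $\rho(\alpha_s(a))=\sigma_s\rho(a)\sigma_{s^*}$ for $a\in A_{s^*s}$; (3) $\rho(A_e)H=\sigma_e(H)$ (where $\rho(A_e)H=\{\rho(a)h:a\in A_e,h\in H\}$ is a closed subspace, by Cohen factorization). *)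

(* Defs.v *)
From HB Require Import structures.
From mathcomp Require Import all_boot all_order all_algebra.
From mathcomp Require Import ring complex finmap.
From mathcomp Require Import showcase.summability.
From mathcomp Require Import all_classical all_reals all_analysis.

Set Implicit Arguments.
Unset Strict Implicit.
Unset Printing Implicit Defensive.

Import Order.TTheory GRing.Theory Num.Theory.
Import numFieldNormedType.Exports.

Local Open Scope classical_set_scope.
Local Open Scope ring_scope.

HB.mixin Record Semigroup_isInverse S of Semigroup S := {
  sinv : S -> S;
  mul_sinv_mul : forall s : S, (s * sinv s * s)%g = s;
  sinv_mul_sinv : forall s : S, (sinv s * s * sinv s)%g = sinv s;
  sinv_unique : forall s t : S,
    (s * t * s)%g = s -> (t * s * t)%g = t -> t = sinv s
}.

#[short(type="invSemigroupType")]
HB.structure Definition InverseSemigroup :=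
  {S of Semigroup S & Semigroup_isInverse S}.

Notation "s ^*" := (sinv s) : group_scope.

Definition sidem (S : semigroupType) (e : S) : Prop := (e * e)%g = e.

(* C*-algebras need not be unital, so the product is not one of the ring
   structures of the library. *)
HB.mixin Record NormedModule_isCStarAlgebra (R : realType) A
    of CompleteNormedModule R[i] A := {
  amul : A -> A -> A;
  astar : A -> A;
  amulA : associative amul;
  amulDl : left_distributive amul +%R;
  amulDr : right_distributive amul +%R;
  amulZl : forall (c : R[i]) (a b : A), amul (c *: a) b = c *: amul a b;
  amulZr : forall (c : R[i]) (a b : A), amul a (c *: b) = c *: amul a b;
  astarK : involutive astar;
  astarD : {morph astar : a b / a + b};
  astarZ : forall (c : R[i]) (a : A), astar (c *: a) = c^* *: astar a;
  astarM : forall a b : A, astar (amul a b) = amul (astar b) (astar a);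
  amul_norm : forall a b : A, `|amul a b| <= `|a| * `|b|;
  astar_norm : forall a : A, `|amul (astar a) a| = `|a| ^+ 2
}.

#[short(type="cstarType")]
HB.structure Definition CStarAlgebra (R : realType) :=
  {A of CompleteNormedModule R[i] A & NormedModule_isCStarAlgebra R A}.

Notation "a ** b" := (amul a b) (at level 40, left associativity) : ring_scope.

(* The inner product is linear in its first argument. *)
HB.mixin Record NormedModule_isHilbert (R : realType) H
    of CompleteNormedModule R[i] H := {
  inner : {dot H for Num.conj};
  inner_norm : forall x : H, inner x x = `|x| ^+ 2
}.

#[short(type="hilbertType")]
HB.structure Definition Hilbert (R : realType) :=
  {H of CompleteNormedModule R[i] H & NormedModule_isHilbert R H}.

Section dot_norm.
Variables (R : realType) (U : lmodType R[i]) (dot : {dot U for Num.conj}).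

Lemma dot_norm_triangle (u v : U) :
  sqrtC (dot (u + v) (u + v)) <= sqrtC (dot u u) + sqrtC (dot v v).
Proof.
have dge0 w : 0 <= dot w w by apply: dnorm_ge0.
have [->|u0] := eqVneq u 0; first by rewrite add0r ler_wpDl// sqrtC_ge0.
have [->|v0] := eqVneq v 0; first by rewrite addr0 ler_wpDr// sqrtC_ge0.
set a := sqrtC (dot u u); set b := sqrtC (dot v v).
have a0 : 0 < a by rewrite sqrtC_gt0; apply: neq0_dnorm_gt0.
have b0 : 0 < b by rewrite sqrtC_gt0; apply: neq0_dnorm_gt0.
have aE : dot u u = a ^+ 2 by rewrite sqrtCK.
have bE : dot v v = b ^+ 2 by rewrite sqrtCK.
have CS : dot u v + (dot u v)^* <= 2 * (a * b).
  have dE : dot (b *: u) (a *: v) = a * b * dot u v.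
    rewrite linearZl_LR linearZr_LR/= (CrealP _) ?gtr0_real//; ring.
  have abr : (a * b)^* = a * b by apply/CrealP; rewrite realM ?gtr0_real.
  have cE : (a * b * dot u v)^* = a * b * (dot u v)^* by rewrite -[in RHS]abr -rmorphM.
  have := dge0 (b *: u - a *: v).
  rewrite dnormB !dnormZ !gtr0_norm// aE bE dE cE.
  have -> : b ^+ 2 * a ^+ 2 + a ^+ 2 * b ^+ 2 -
     (a * b * dot u v + a * b * (dot u v)^*) =
     (a * b) * (2 * (a * b) - (dot u v + (dot u v)^*)) by ring.
  by rewrite pmulr_rge0 ?mulr_gt0// subr_ge0.
have ab0 : 0 <= a + b by rewrite addr_ge0 ?ltW.
rewrite -[leRHS]sqrCK// ler_sqrtC ?nnegrE ?exprn_ge0//.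
rewrite dnormD aE bE sqrrD [leRHS]addrAC lerD2l.
by apply: le_trans CS _; rewrite mulr_natl.
Qed.

End dot_norm.

#[local] Existing Instance totally_filter.

Section nonneg_sum.
Variables (R : realType) (I : choiceType).
Local Notation C := R[i].
Implicit Types (u : I -> C) (J : {fset I}).

Lemma partial_sumE (V : zmodType) (x : I -> V) J :
  partial_sum x J = \sum_(i <- J) x i.
Proof. by rewrite /partial_sum big_seq_fsetE. Qed.

Lemma sum_fset_le u J J' : (forall i, 0 <= u i) -> fsubset J J' ->
  \sum_(i <- J) u i <= \sum_(i <- J') u i.
Proof.
move=> u0 JJ'.
rewrite [leRHS](bigID (mem J))/= [X in _ <= X + _](_ : _ = \sum_(i <- J) u i).
  by rewrite lerDl sumr_ge0.
rewrite -big_filter; apply: perm_big; apply: uniq_perm => [||i].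
- by rewrite filter_uniq ?fset_uniq.
- exact: fset_uniq.
- by rewrite mem_filter; case iJ: (i \in J) => //=; rewrite (fsubsetP JJ').
Qed.

Lemma ge0_sum_cvg u (M : C) : (forall i, 0 <= u i) ->
  (forall J, \sum_(i <- J) u i <= M) ->
  exists s : C, [/\ (partial_sum (u : I -> C^o) J @[J --> totally] --> (s : C^o)),
    (forall J, \sum_(i <- J) u i <= s) &
    (forall N, (forall J, \sum_(i <- J) u i <= N) -> s <= N)].
Proof.
move=> u0 uM.
have s0 J : 0 <= \sum_(i <- J) u i by rewrite sumr_ge0.
have sE J : \sum_(i <- J) u i = (complex.Re (\sum_(i <- J) u i))%:C%C.
  by rewrite RRe_real ?ger0_real.
pose E := range (fun J => complex.Re (\sum_(i <- J) u i)).
have ubE N : (forall J, \sum_(i <- J) u i <= N) -> ubound E (complex.Re N).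
  move=> uN _ [J _ <-]; rewrite -lecR -sE RRe_real ?uN//.
  exact: ger0_real (le_trans (s0 J) (uN J)).
have E0 : E !=set0 by exists (complex.Re (\sum_(i <- fset0) u i)); exists fset0.
have supE : has_sup E by split=> //; exists (complex.Re M); exact: ubE.
exists (sup E)%:C%C; split.
- apply/cvgrPdist_lt => e e0; rewrite -[e]RRe_real ?gtr0_real//.
  have e0' : 0 < complex.Re e by rewrite -ltcR RRe_real ?gtr0_real.
  have [_ [J0 _ <-] J0e] := sup_adherent e0' supE.
  exists J0 => // J /= J0J; rewrite partial_sumE sE -rmorphB/=.
  have JE : complex.Re (\sum_(i <- J) u i) <= sup E.
    by apply: ub_le_sup; [exact: supE.2|exists J].
  rewrite ger0_norm ?(lecR 0) ?subr_ge0// ltcR ltrBlDr addrC -ltrBlDr.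
  apply: lt_le_trans J0e _; rewrite -lecR -!sE.
  exact: sum_fset_le.
- move=> J; rewrite sE lecR; apply: ub_le_sup; [exact: supE.2|by exists J].
- move=> N uN; have N0 : 0 <= N by apply: le_trans (uN fset0).
  rewrite -[N]RRe_real ?ger0_real// lecR.
  by apply: ge_sup => //; exact: ubE.
Qed.

Lemma summable_bounded u : (forall i, 0 <= u i) ->
  esum.summable [set: I] (fun i => (complex.Re (u i))%:E) <->
  exists M : C, forall J, \sum_(i <- J) u i <= M.
Proof.
move=> u0.
have sE J : \sum_(i <- J) u i = (\sum_(i <- J) complex.Re (u i))%:C%C.
  by rewrite rmorph_sum/=; apply: eq_bigr => i _; rewrite RRe_real ?ger0_real.
have r0 i : 0 <= complex.Re (u i) by rewrite -lecR RRe_real ?ger0_real.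
rewrite /esum.summable /esum; split.
  set s := ereal_sup _ => sfin.
  exists (fine s)%:C%C => J; rewrite sE lecR -lee_fin fineK; last first.
    rewrite ge0_fin_numE//; apply: ereal_sup_ubound; exists set0.
      exact: fsets_set0.
    by rewrite fsbig_set0.
  apply: ereal_sup_ubound; exists [set` J].
    by split => //; exact: finite_fset.
  rewrite fsbig_finite ?finite_fset//= set_fsetK -sumEFin.
  by apply: eq_bigr => i _ /=; rewrite ger0_norm.
move=> [M uM]; apply: (@le_lt_trans _ _ (complex.Re M)%:E); last exact: ltry.
apply: ge_ereal_sup => _ [A [finA _] <-].
rewrite fsbig_finite//= (eq_bigr (fun i => (complex.Re (u i))%:E)); last first.
  by move=> i _ /=; rewrite ger0_norm.
rewrite sumEFin lee_fin -lecR -sE RRe_real ?uM//.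
by apply: ger0_real; apply: le_trans (uM fset0); rewrite big_seq_fset0.
Qed.

End nonneg_sum.

Section ell2.
Variables (R : realType) (I : choiceType) (H : hilbertType R).
Local Notation C := R[i].

Definition sq_summable : {pred I -> H} :=
  fun f => esum.summable [set: I] (fun i => (complex.Re (`|f i| ^+ 2))%:E).

Lemma sq_summableP (f : I -> H) : f \in sq_summable <->
  exists M : C, forall J : {fset I}, \sum_(i <- J) `|f i| ^+ 2 <= M.
Proof. by apply: summable_bounded => i; rewrite exprn_ge0. Qed.

Lemma normD_sq (x y : H) : `|x + y| ^+ 2 <= 2 * (`|x| ^+ 2 + `|y| ^+ 2).
Proof.
have xy : `|x + y| ^+ 2 <= (`|x| + `|y|) ^+ 2.
  by rewrite lerXn2r ?nnegrE ?addr_ge0 ?ler_normD.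
apply: le_trans xy _; rewrite -subr_ge0.
have -> : 2 * (`|x| ^+ 2 + `|y| ^+ 2) - (`|x| + `|y|) ^+ 2 = (`|x| - `|y|) ^+ 2 by ring.
by rewrite real_exprn_even_ge0// rpredB ?normr_real.
Qed.

Fact sq_summable_submod : submod_closed sq_summable.
Proof.
split=> [|c f g /sq_summableP[M fM] /sq_summableP[N gN]].
  by apply/sq_summableP; exists 0 => J; rewrite big1// => i _; rewrite normr0 expr0n.
apply/sq_summableP; exists (2 * (`|c| ^+ 2 * M + N)) => J.
apply: (@le_trans _ _ (\sum_(i <- J) 2 * (`|c| ^+ 2 * `|f i| ^+ 2 + `|g i| ^+ 2))).
  by apply: ler_sum => i _; rewrite -exprMn -normrZ; exact: normD_sq.
rewrite -mulr_sumr big_split/= -mulr_sumr ler_wpM2l// lerD//.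
by rewrite ler_wpM2l ?exprn_ge0.
Qed.

HB.instance Definition _ := GRing.isSubmodClosed.Build _ _ sq_summable
  sq_summable_submod.

Record ell2 := Ell2 { ell2_fun :> I -> H; ell2P : ell2_fun \in sq_summable }.

HB.instance Definition _ := [isSub for ell2_fun].
HB.instance Definition _ := [Choice of ell2 by <:].
HB.instance Definition _ := [SubChoice_isSubLmodule of ell2 by <:].

Implicit Types f g h : ell2.

Lemma ell2_eqP f g : (forall i, f i = g i) -> f = g.
Proof. by move=> fg; apply/val_inj/funext. Qed.

Lemma ell2D f g i : (f + g) i = f i + g i. Proof. by []. Qed.
Lemma ell2B f g i : (f - g) i = f i - g i. Proof. by []. Qed.
Lemma ell2Z (c : C) f i : (c *: f) i = c *: f i. Proof. by []. Qed.
Lemma ell20 i : (0 : ell2) i = 0. Proof. by []. Qed.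

Definition ell2_dot f g : C := summability.sum (fun i => inner (f i) (g i) : C^o).

Lemma polarization (x y : H) : inner x y = 4^-1 *
  ((`|x + y| ^+ 2 - `|x - y| ^+ 2)
   + 'i * (`|x + 'i *: y| ^+ 2 - `|x - 'i *: y| ^+ 2)).
Proof.
have cE : inner x ('i *: y) = - 'i * inner x y.
  by rewrite linearZr_LR -conjCi.
rewrite -!inner_norm !dnormB !dnormD !dnormZ normCi expr1n mul1r cE.
set d := inner x y.
have dJ : (- 'i * d)^* = 'i * d^* 
  by rewrite -conjCi rmorphM; congr (_ * _); exact: conjCK.
rewrite dJ; have i2 : 'i * 'i = -1 :> C by rewrite -expr2 sqrCi.
transitivity (4^-1 * (2 * (d + d^* ) + 2 * ('i * 'i) * (d^* - d))).
  by rewrite i2; field.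
by ring.
Qed.

Let psum (u : I -> C) (J : {fset I}) : C^o := partial_sum (u : I -> C^o) J.

Let sq_cvg f : psum (fun i => `|f i| ^+ 2) J @[J --> totally] -->
  (lim (psum (fun i => `|f i| ^+ 2) J @[J --> totally]) : C^o).
Proof.
have [M fM] := (sq_summableP f).1 (ell2P f).
have [|s [fs _ _]] := ge0_sum_cvg _ fM; first by move=> i; rewrite exprn_ge0.
by apply/cvg_ex; exists s.
Qed.

Let psumD u v J : psum (fun i => u i + v i) J = psum u J + psum v J.
Proof. by rewrite /psum !partial_sumE big_split. Qed.

Let psumZ (c : C) u J : psum (fun i => c * u i) J = c *: psum u J.
Proof. by rewrite /psum !partial_sumE -mulr_sumr. Qed.

Let cvgpD u v (a b : C^o) : psum u J @[J --> totally] --> a ->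
  psum v J @[J --> totally] --> b ->
  psum (fun i => u i + v i) J @[J --> totally] --> a + b.
Proof.
move=> ua vb; rewrite (_ : psum _ = psum u \+ psum v); first exact: cvgD.
by apply/funext => J; rewrite psumD.
Qed.

Let cvgpZ c u (a : C^o) : psum u J @[J --> totally] --> a ->
  psum (fun i => c * u i) J @[J --> totally] --> c *: a.
Proof.
move=> ua; rewrite (_ : psum _ = c \*: psum u); first exact: cvgZr.
by apply/funext => J; rewrite psumZ.
Qed.

Lemma ell2_dot_cvg f g :
  psum (fun i => inner (f i) (g i)) J @[J --> totally] --> (ell2_dot f g : C^o).
Proof.
apply/cvg_ex.
have cB h h' : exists a : C^o,
    psum (fun i => `|h i| ^+ 2 - `|h' i| ^+ 2) J @[J --> totally] --> a.
  eexists; rewrite (_ : (fun i => _) =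
    fun i => `|h i| ^+ 2 + -1 * `|h' i| ^+ 2); last first.
    by apply/funext => i; rewrite mulN1r.
  by apply: cvgpD; [exact: sq_cvg|apply: cvgpZ; exact: sq_cvg].
have [a ca] := cB (f + g) (f - g).
have [b cb] := cB (f + 'i *: g) (f - 'i *: g).
have := cvgpZ (c := 4^-1) (cvgpD ca (cvgpZ (c := 'i) cb)).
set l := (X in _ --> X) => cl; exists l.
rewrite (_ : (fun i => _) = (fun i => 4^-1 *
  (`|(f + g) i| ^+ 2 - `|(f - g) i| ^+ 2 +
   'i * (`|(f + 'i *: g) i| ^+ 2 - `|(f - 'i *: g) i| ^+ 2)))) //.
by apply/funext => i; rewrite polarization.
Qed.

Arguments ell2_dot_cvg : clear implicits.

Let psum_lim u (a b : C) : psum u J @[J --> totally] --> (a : C^o) ->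
  psum u J @[J --> totally] --> (b : C^o) -> a = b.
Proof. by move=> ua ub; exact: (@cvg_unique C^o _ _ _ _ _ ua ub). Qed.

Fact ell2_dotDl h : zmod_morphism (ell2_dot^~ h).
Proof.
move=> f g /=; apply: psum_lim (ell2_dot_cvg (f - g) h) _.
rewrite (_ : (fun i => _) =
    fun i => inner (f i) (h i) + -1 * inner (g i) (h i)); last first.
  by apply/funext => i; rewrite linearBl mulN1r.
rewrite -[X in _ + X]scaleN1r.
by apply: cvgpD; [|apply: cvgpZ]; exact: ell2_dot_cvg.
Qed.

Fact ell2_dotZl h : scalable_for *%R (ell2_dot^~ h).
Proof.
move=> c f /=; apply: psum_lim (ell2_dot_cvg (c *: f) h) _.
rewrite (_ : (fun i => _) = fun i => c * inner (f i) (h i)); last first.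
  by apply/funext => i; rewrite linearZl_LR.
by apply: cvgpZ; exact: ell2_dot_cvg.
Qed.

Fact ell2_dotC f g : ell2_dot f g = (-1) ^+ false * Num.conj (ell2_dot g f).
Proof.
rewrite expr0 mul1r; apply: psum_lim (ell2_dot_cvg f g) _.
apply/cvgrPdist_lt => e e0.
have /cvgrPdist_lt/(_ _ e0) := ell2_dot_cvg g f.
apply: filterS => J; rewrite -norm_conjC rmorphB /psum !partial_sumE rmorph_sum/=.
rewrite (eq_bigr (fun i => inner (f i) (g i)))// => i _.
by rewrite [RHS]hermC expr0 mul1r.
Qed.

Fact ell2_dotDr h : zmod_morphism (ell2_dot h).
Proof. by move=> f g; rewrite !(ell2_dotC h) expr0 !mul1r ell2_dotDl rmorphB. Qed.

Fact ell2_dotZr h : scalable_for (Num.conj \; *%R) (ell2_dot h).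
Proof. by move=> c f; rewrite !(ell2_dotC h) expr0 !mul1r ell2_dotZl rmorphM. Qed.

Lemma ell2_dot_bound f :
  (forall J : {fset I}, \sum_(i <- J) `|f i| ^+ 2 <= ell2_dot f f) /\
  (forall M : C, (forall J : {fset I}, \sum_(i <- J) `|f i| ^+ 2 <= M) ->
     ell2_dot f f <= M).
Proof.
have [M fM] := (sq_summableP f).1 (ell2P f).
have [|s [fs s1 s2]] := ge0_sum_cvg _ fM; first by move=> i; rewrite exprn_ge0.
rewrite (_ : ell2_dot f f = s)//; apply: psum_lim (ell2_dot_cvg f f) _.
rewrite (_ : (fun i => inner _ _) = (fun i => `|f i| ^+ 2))//.
by apply/funext => i; rewrite inner_norm.
Qed.

Lemma ell2_le_dot f i : `|f i| ^+ 2 <= ell2_dot f f.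
Proof.
by have := (ell2_dot_bound f).1 [fset i]%fset; rewrite big_seq_fset1.
Qed.

Fact ell2_dot_gt0 f : f != 0 -> 0 < ell2_dot f f.
Proof.
apply: contra_neqT => f0; apply: ell2_eqP => i; apply/eqP.
apply: contraNT f0 => fi0; apply: lt_le_trans (ell2_le_dot f i).
by rewrite exprn_gt0// normr_gt0.
Qed.

HB.instance Definition _ := @isBilinear.Build C ell2 ell2 C *%R (Num.conj \; *%R)
  ell2_dot ell2_dotDl ell2_dotDr ell2_dotZl ell2_dotZr.
HB.instance Definition _ := @isHermitianSesquilinear.Build C ell2 false Num.conj
  ell2_dot ell2_dotC.
HB.instance Definition _ := @isDotProduct.Build C ell2 ell2_dot ell2_dot_gt0.

Definition ell2_norm f : C := sqrtC (ell2_dot f f).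

Fact ell2_normD f g : ell2_norm (f + g) <= ell2_norm f + ell2_norm g.
Proof. exact: (dot_norm_triangle ell2_dot). Qed.

Fact ell2_normZ (c : C) f : ell2_norm (c *: f) = `|c| * ell2_norm f.
Proof.
rewrite /ell2_norm (dnormZ ell2_dot) rootCMl ?exprn_ge0//.
by rewrite sqrCK.
Qed.

Fact ell2_norm0_eq0 f : ell2_norm f = 0 -> f = 0.
Proof. by move=> /eqP; rewrite (sqrt_dnorm_eq0 ell2_dot) => /eqP. Qed.

HB.instance Definition _ := Lmodule_isNormed.Build C ell2
  ell2_normD ell2_normZ ell2_norm0_eq0.

Fact ell2_dot_norm f : ell2_dot f f = `|f| ^+ 2.
Proof. by rewrite -[X in _ = X ^+ 2]/(ell2_norm f) sqrtCK. Qed.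

Lemma ell2_norm_eval f i : `|f i| <= `|f|.
Proof.
by rewrite -(@ler_pXn2r _ 2)// ?nnegrE// -ell2_dot_norm ell2_le_dot.
Qed.

Lemma cvg_le_bound (T : Type) (F : set_system T) (u : T -> C^o) (a : C^o) (M : C) :
  ProperFilter F -> u @ F --> a -> (forall t, 0 <= u t) -> 0 <= a -> 0 <= M ->
  (\forall t \near F, u t <= M) -> a <= M.
Proof.
move=> FF ua u0 a0 M0 uM.
rewrite real_leNgt ?ger0_real//; apply/negP => Ma.
have /cvgrPdist_lt/(_ (a - M)) := ua; rewrite subr_gt0 => /(_ Ma) near_a.
have [t [/= ut1 ut2]] := filter_ex (filterI near_a uM).
have : `|a - u t| < `|a - u t|.
  apply: lt_le_trans ut1 _; rewrite ger0_norm ?lerB//.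
  by rewrite subr_ge0 (le_trans ut2)// ltW.
by rewrite ltxx.
Qed.

Fact ell2_complete (F : set_system ell2) : ProperFilter F -> cauchy F -> cvg F.
Proof.
move=> FF /cauchyP Fc.
have Fc2 e : 0 < e -> exists2 A : set ell2, F A &
    forall f g, A f -> A g -> `|f - g| <= e.
  move=> e0; have [|h Fh] := Fc (e / 2); first by rewrite divr_gt0.
  exists (ball h (e / 2)) => // f g; rewrite -ball_normE/= => hf hg.
  rewrite -(subrKA h) (le_trans (ler_normD _ _))// [leRHS](splitr e).
  by rewrite lerD// ltW// distrC.
have cvi i : cvg ((fun f : ell2 => f i) @ F).
  apply: cauchy_cvg; apply/cauchyP => e e0; have [h Fh] := Fc e e0.
  exists (h i); suff: F [set f : ell2 | ball (h i) e (f i)] by [].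
  apply: filterS Fh => f; rewrite -!ball_normE/=.
  exact: le_lt_trans (ell2_norm_eval (h - f) i).
pose l i := lim ((fun f : ell2 => f i) @ F).
have key e A f (J : {fset I}) : 0 <= e -> F A ->
    (forall f g, A f -> A g -> `|f - g| <= e) -> A f ->
    \sum_(i <- J) `|f i - l i| ^+ 2 <= e ^+ 2.
  move=> e0 FA Ae Af.
  apply: (@cvg_le_bound _ F (fun g : ell2 => \sum_(i <- J) `|f i - g i| ^+ 2)).
  - elim: (J : seq I) => [|j s IH].
      rewrite big_nil (_ : (fun g => _) = cst 0); first exact: cvg_cst.
      by apply/funext => g; rewrite big_nil.
    rewrite big_cons (_ : (fun g => _) = (fun g : ell2 => `|f j - g j| ^+ 2) \+
      (fun g : ell2 => \sum_(i <- s) `|f i - g i| ^+ 2)); last first.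
      by apply/funext => g; rewrite big_cons.
    apply: cvgD IH.
    have cn : (fun g : ell2 => `|f j - g j| : C^o) @ F --> (`|f j - l j| : C^o).
      by apply: cvg_norm; apply: cvgB; [exact: cvg_cst|exact: cvi].
    exact: (cvgM cn cn).
  - by move=> g; rewrite sumr_ge0// => i _; rewrite exprn_ge0.
  - by rewrite sumr_ge0// => i _; rewrite exprn_ge0.
  - by rewrite exprn_ge0.
  - apply: filterS FA => g Ag.
    apply: le_trans ((ell2_dot_bound (f - g)).1 J) _.
    by rewrite ell2_dot_norm lerXn2r ?nnegrE// Ae.
have lS : l \in sq_summable.
  have [A FA Ae] := Fc2 1 ltr01; have [f Af] := filter_ex FA.
  have flS : (fun i => f i - l i) \in sq_summable.
    by apply/sq_summableP; exists (1 ^+ 2) => J; exact: key Af.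
  have -> : l = (f : I -> H) - (fun i => f i - l i).
    by apply/funext => i; rewrite !fctE opprB addrCA subrr addr0.
  exact: rpredB (ell2P f) flS.
apply/cvg_ex; exists (Ell2 lS); apply/cvgrPdist_le => e e0.
have [A FA Ae] := Fc2 e e0; apply: filterS (FA) => f Af.
rewrite distrC -(@ler_pXn2r _ 2)// ?nnegrE ?(ltW e0)// -ell2_dot_norm.
by apply: (ell2_dot_bound (f - Ell2 lS)).2 => J; apply: (key e A) => //; exact: ltW.
Qed.

HB.instance Definition _ := Uniform_isComplete.Build ell2 ell2_complete.
HB.instance Definition _ := @NormedModule_isHilbert.Build R ell2 ell2_dot
  ell2_dot_norm.

End ell2.

Definition lin_span (K : nzRingType) (V : lmodType K) (X : set V) : set V :=
  [set v | exists (n : nat) (c : 'I_n -> K) (x : 'I_n -> V),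
     (forall i, X (x i)) /\ v = \sum_i c i *: x i].

Definition lin_subspace (K : nzRingType) (V : lmodType K) (W : set V) : Prop :=
  W 0 /\ forall (c : K) (x y : V), W x -> W y -> W (c *: x + y).

Record ideal (R : realType) (A : cstarType R) (J : set A) : Prop := {
  ideal_subspace : lin_subspace J;
  ideal_closed : closed J;
  ideal_mull : forall a b : A, J b -> J (a ** b);
  ideal_mulr : forall a b : A, J a -> J (a ** b)
}.

(* A partial bijection of X is an injective partial function; None means
   "undefined". *)
Record pbij (X : Type) := PBij {
  pbij_fun :> X -> option X;
  pbij_inj : forall x y z, pbij_fun x = Some z -> pbij_fun y = Some z -> x = y
}.

Definition pdom (X : Type) (f : pbij X) : set X := [set x | f x].

(* The range of [act s] is the domain of [act s^*], hence also an ideal. *)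
Record action (S : invSemigroupType) (R : realType) (A : cstarType R) := Action {
  act :> S -> pbij A;
  act_mul : forall s t : S, act (s * t)%g =1 pcomp (act s) (act t);
  act_ideal : forall s : S, ideal (pdom (act s));
  act_linear : forall (s : S) (c : R[i]) (a b a' b' : A),
    act s a = Some a' -> act s b = Some b' ->
    act s (c *: a + b) = Some (c *: a' + b');
  act_amul : forall (s : S) (a b a' b' : A),
    act s a = Some a' -> act s b = Some b' -> act s (a ** b) = Some (a' ** b');
  act_astar : forall (s : S) (a a' : A),
    act s a = Some a' -> act s (astar a) = Some (astar a');
  act_dense :
    closure (lin_span (\bigcup_(s in [set: S]) pdom (act (s^* * s)%g))) = setT
}.

Record bop (R : realType) (H : hilbertType R) := BOp {
  bop_fun :> {linear H -> H};
  bop_bounded : exists M : R[i], forall x : H, `|bop_fun x| <= M * `|x|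
}.

Definition adjoint (R : realType) (H : hilbertType R) (f g : bop H) : Prop :=
  forall x y : H, inner (f x) y = inner x (g y).

Record representation (R : realType) (A : cstarType R) (H : hilbertType R) :=
  Representation {
  rep_op :> A -> bop H;
  rep_linear : forall (c : R[i]) (a b : A) (x : H),
    rep_op (c *: a + b) x = c *: rep_op a x + rep_op b x;
  rep_amul : forall (a b : A) (x : H), rep_op (a ** b) x = rep_op a (rep_op b x);
  rep_astar : forall a : A, adjoint (rep_op (astar a)) (rep_op a)
}.

HB.instance Definition _ (R : realType) (A : cstarType R) (H : hilbertType R) :=
  gen_eqMixin (representation A H).
HB.instance Definition _ (R : realType) (A : cstarType R) (H : hilbertType R) :=
  gen_choiceMixin (representation A H).

Definition nondegenerate_rep (R : realType) (A : cstarType R) (H : hilbertType R)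
    (rho : representation A H) : Prop :=
  closure (lin_span [set v | exists a x, v = rho a x]) = setT.

Definition irreducible_rep (R : realType) (A : cstarType R) (H : hilbertType R)
    (pi : representation A H) : Prop :=
  (exists a x, pi a x != 0) /\
  forall W : set H, lin_subspace W -> closed W ->
    (forall a x, W x -> W (pi a x)) -> W = [set 0] \/ W = setT.

(* Equality of the classes of pi and eta in the spectrum of A. *)
Definition unitarily_equivalent (R : realType) (A : cstarType R)
    (H K : hilbertType R) (pi : representation A H) (eta : representation A K) :
    Prop :=
  exists U : {linear H -> K}, [/\ forall x, `|U x| = `|x|,
    forall y, exists x, U x = y & forall a x, U (pi a x) = eta a (U x)].

(* For irreducible pi: the class of pi lies in the open subset of the spectrum
   of A identified with the spectrum of the ideal J. *)
Definition in_hat (R : realType) (A : cstarType R) (H : hilbertType R)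
    (J : set A) (pi : representation A H) : Prop :=
  exists a x, J a /\ pi a x != 0.

Section induced_action.
Variables (S : invSemigroupType) (R : realType) (A : cstarType R).
Variables (alpha : action S A) (H : hilbertType R).
Implicit Types (pi : representation A H) (s t e : S).

(* beta_s(pi): the representation of A extending pi \o alpha_(s^* ), which is
   defined on the domain of alpha_(s^* ).  It exists and is unique when pi is
   irreducible and lies over the domain of alpha_s; [xget] returns pi if there
   is no such representation. *)
Definition induced_rep s pi : representation A H :=
  xget pi [set eta : representation A H |
    forall a b, alpha s^*%g a = Some b -> forall x, eta a x = pi b x].

Definition over_dom pi s : Prop := in_hat (pdom (alpha (s^* * s)%g)) pi.

Definition germ_equiv (K : hilbertType R) s pi t (eta : representation A K) :
    Prop :=
  unitarily_equivalent pi eta /\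
  exists e, [/\ sidem e, in_hat (pdom (alpha e)) pi & (s * e = t * e)%g].

(* All the germs at a fixed pi have the same second component, so [t, pi] is
   encoded by the set of the s such that (s, pi) is equivalent to (t, pi). *)
Definition germ_class pi t : set S :=
  [set s | over_dom pi s /\ germ_equiv s pi t pi].

Record germ pi := MkGerm {
  germ_set : set S;
  germP : exists2 t, over_dom pi t & germ_set = germ_class pi t
}.

HB.instance Definition _ pi := gen_eqMixin (germ pi).
HB.instance Definition _ pi := gen_choiceMixin (germ pi).

Definition germ_of pi t (ht : over_dom pi t) : germ pi :=
  MkGerm (ex_intro2 _ _ t ht erefl).

End induced_action.

Record covariant_rep (S : invSemigroupType) (R : realType) (A : cstarType R)
    (alpha : action S A) (H : hilbertType R)
    (rho : representation A H) (sigma : S -> bop H) : Prop := {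
  cov_nondeg : nondegenerate_rep rho;
  cov_mul : forall (s t : S) (x : H), sigma (s * t)%g x = sigma s (sigma t x);
  cov_star : forall s : S, adjoint (sigma s^*%g) (sigma s);
  cov_act : forall (s : S) (a b : A), alpha s a = Some b ->
    forall x : H, rho b x = sigma s (rho a (sigma s^*%g x));
  cov_range : forall e : S, sidem e ->
    [set v | exists a x, pdom (alpha e) a /\ v = rho a x] = range (sigma e)
}.

(* Main.v *)
From HB Require Import structures.
Require Import Defs.
From mathcomp Require Import all_boot all_order all_algebra.
From mathcomp Require Import complex ring lra finmap.
From mathcomp Require Import showcase.summability.
From mathcomp Require Import all_classical all_reals all_analysis.

Set Implicit Arguments.
Unset Strict Implicit.
Unset Printing Implicit Defensive.

Import Order.TTheory GRing.Theory Num.Theory.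
Import numFieldNormedType.Exports.

Local Open Scope classical_set_scope.
Local Open Scope ring_scope.

(** Both operators are defined fibrewise over the germs at [pi]: [rho_pi(a)] is
    diagonal with entries [beta_t(pi)(a)], and [sigma_pi(s)] is the partial
    isometry induced by the partial bijection [[t, pi] |-> [s^* t, pi]]. Hence
    conditions (1) and (2) reduce to facts about single germs. That
    [sigma_pi] is multiplicative and adjoint-preserving is the computation
    that [s |-> ([t, pi] |-> [s^* t, pi])] reverses products and sends [s^*]
    to the inverse partial bijection, where [[s s^* t, pi] = [t, pi]] because
    [t] and [s s^* t] agree after multiplication by the idempotent
    [t^* s s^* t] (lemmas [germ_act_mul] and [germ_act_sinv]). Condition (2) is
    the identity [beta_t(pi)(alpha_s(a)) = beta_(s^* t)(pi)(a)]
    (lemma [induced_rep_mul]).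

    The analytic input is Cohen factorization for representations on a Hilbert
    space: if [J] is an ideal and [v] is in the closed span of [rho(J) K], then
    [v = rho(b) w] with [b] in [J] (lemma [closed_span_factorization]). It is
    used three times. In the irreducible representation [pi] it shows that every
    vector is [pi(b) w] with [b] in any ideal on which [pi] does not vanish,
    which gives the extension of [pi \o alpha_(t^* )] from an ideal to [A] as
    the operator [pi(b) w |-> pi(alpha_(t^* )(a alpha_t(b))) w], together with
    all comparisons between the representations [beta_t(pi)]. At a single germ
    it shows that a vector concentrated there is exactly [rho_pi(a) w]. Applied
    to [rho_pi] itself it yields condition (3), an equality with a set of single
    products [rho_pi(a) xi] rather than with the closure of their span.

    No functional calculus is needed. If [k] is self-adjoint of norm at most
    [3/4], a fixed point argument gives a square root [1 - y] of [1 - k] (lemma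
    [sqrt_one_minus]). With [k = a^* a] this proves that representations are
    bounded by [2 |a|] uniformly (lemma [gram_bound]), so that [rho_pi(a)] is
    bounded. With [k = h^2] it makes a small self-adjoint [h] the imaginary part
    of a unitary [1 + q] with [q] in [J], and averaging the powers of this
    unitary, as in the mean ergodic theorem, produces an approximate unit of [J]
    consisting of elements [u] with [1 - u] contractive
    (lemma [averaged_powers]). *)

(** * Real-valued norms *)

Section RealNorm.
Variables (R : realType).
Local Notation C := R[i].

(** The norms of the complex structures take values in [R[i]]; their real
    parts live in an ordered field, where linear arithmetic can be automated. *)
Definition rnorm (V : normedModType C) (x : V) : R := complex.Re `|x|.

Section Basic.
Variable V : normedModType C.
Implicit Types x y : V.

Lemma rnormE x : `|x| = (rnorm x)%:C%C.
Proof. by rewrite /rnorm RRe_real. Qed.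

Lemma rnorm_ge0 x : 0 <= rnorm x.
Proof. by rewrite -lecR -rnormE; exact: normr_ge0. Qed.

Lemma le_rnorm x (y : C) : (`|x| <= y) -> rnorm x <= complex.Re y.
Proof.
move=> xy; rewrite -lecR -rnormE RRe_real//.
exact: ger0_real (le_trans (normr_ge0 _) xy).
Qed.

Lemma rnorm0 : rnorm (0 : V) = 0. Proof. by rewrite /rnorm normr0. Qed.

Lemma rnorm_eq0 x : rnorm x = 0 -> x = 0.
Proof. by move=> x0; apply/normr0_eq0; rewrite rnormE x0. Qed.

Lemma rnormN x : rnorm (- x) = rnorm x. Proof. by rewrite /rnorm normrN. Qed.

Lemma rnormBC x y : rnorm (x - y) = rnorm (y - x).
Proof. by rewrite /rnorm distrC. Qed.

Lemma rnormD x y : rnorm (x + y) <= rnorm x + rnorm y.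
Proof. by have := le_rnorm (ler_normD x y); rewrite raddfD. Qed.

Lemma rnormB x y : rnorm (x - y) <= rnorm x + rnorm y.
Proof. by have := rnormD x (- y); rewrite rnormN. Qed.

Lemma rnormZ (c : C) x : rnorm (c *: x) = complex.Re `|c| * rnorm x.
Proof.
by rewrite /rnorm normrZ (rnormE x) -(RRe_real (normr_real c)) -rmorphM.
Qed.

Lemma rnormZr (r : R) x : 0 <= r -> rnorm (r%:C%C *: x) = r * rnorm x.
Proof. by move=> r0; rewrite rnormZ ger0_norm ?(lecR 0). Qed.

Lemma rnormZi x : rnorm ('i *: x) = rnorm x.
Proof. by rewrite rnormZ normCi mul1r. Qed.

Lemma rnorm_gt0 x : x != 0 -> 0 < rnorm x.
Proof.
move=> x0; rewrite lt_neqAle rnorm_ge0 andbT; apply: contra x0 => /eqP x0.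
by apply/eqP/rnorm_eq0.
Qed.

Lemma rnorm_small x : (forall e : R, 0 < e -> rnorm x <= e) -> x = 0.
Proof.
move=> xe; apply: rnorm_eq0; apply/eqP; rewrite eq_le rnorm_ge0 andbT.
by apply/ler_addgt0Pr => e e0; rewrite add0r; exact: xe.
Qed.

Lemma cvg_rnorm (u : nat -> V) l : u n @[n --> \oo] --> l <->
  forall e : R, 0 < e -> exists N, forall n, (N <= n)%N -> rnorm (u n - l) < e.
Proof.
split=> [/cvgrPdist_lt ul e e0|ul].
  have [|N _ NP] := ul e%:C%C; first by rewrite (ltcR 0).
  by exists N => n Nn; have := NP _ Nn; rewrite /= distrC rnormE ltcR.
apply/cvgrPdist_lt => e e0.
have [|N NP] := ul (complex.Re e).
  by rewrite -ltcR RRe_real ?gtr0_real.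
exists N => // n /= Nn; rewrite distrC rnormE -[e]RRe_real ?gtr0_real// ltcR.
exact: NP.
Qed.

Lemma cvg_rnorm_unique (u : nat -> V) (l l' : V) :
  u n @[n --> \oo] --> l -> u n @[n --> \oo] --> l' -> l = l'.
Proof.
move=> /cvg_rnorm ul /cvg_rnorm ul'; apply/eqP; rewrite -subr_eq0; apply/eqP.
apply: rnorm_small => e e0.
have [|N NP] := ul (e / 2); first by rewrite divr_gt0.
have [|N' NP'] := ul' (e / 2); first by rewrite divr_gt0.
have := NP _ (leq_maxl N N'); have := NP' _ (leq_maxr N N').
have := rnormB (u (maxn N N') - l') (u (maxn N N') - l).
by rewrite opprB addrC subrKA; lra.
Qed.

Lemma closure_rnorm (X : set V) x : closure X x <->
  forall e : R, 0 < e -> exists2 y, X y & rnorm (x - y) < e.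
Proof.
split=> [Xx e e0|Xx B /nbhs_ballP[e /= e0 Be]].
  have [|y [Xy]] := Xx (ball x e%:C%C).
    by apply: nbhsx_ballx; rewrite (ltcR 0).
  by rewrite -ball_normE /= rnormE ltcR => xy; exists y.
have [|y Xy xy] := Xx (complex.Re e).
  by rewrite -ltcR RRe_real ?gtr0_real.
exists y; split=> //; apply: Be; rewrite -ball_normE/=.
by rewrite rnormE -[e]RRe_real ?gtr0_real// ltcR.
Qed.

End Basic.

Lemma lipschitz_cvg (V W : normedModType C) (f : V -> W) (M : R)
    (u : nat -> V) (l : V) :
  (forall x y, rnorm (f x - f y) <= M * rnorm (x - y)) ->
  u n @[n --> \oo] --> l -> f (u n) @[n --> \oo] --> f l.
Proof.
move=> fM /cvg_rnorm ul; apply/cvg_rnorm => e e0.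
have M0 : 0 < `|M| + 1 by rewrite ltr_wpDl.
have [|N NP] := ul (e / (`|M| + 1)); first by rewrite divr_gt0.
exists N => n /NP; rewrite ltr_pdivlMr// => lt_e.
apply: le_lt_trans (fM _ _) _; apply: le_lt_trans _ lt_e.
have := ler_norm M; have := rnorm_ge0 (u n - l); nra.
Qed.

Lemma cvg_rnorm_le (V : normedModType C) (u : nat -> V) l x (M : R) :
  u n @[n --> \oo] --> l -> (forall n, rnorm (u n - x) <= M) ->
  rnorm (l - x) <= M.
Proof.
move=> /cvg_rnorm ul uM; apply/ler_addgt0Pr => e e0.
have [N /(_ _ (leqnn N))] := ul e e0; rewrite rnormBC => Ne.
have := rnormD (l - u N) (u N - x); rewrite subrKA; have := uM N; lra.
Qed.

(** The partial increments are dominated by a geometric series, so the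
    sequence is Cauchy. The limits that give square roots, inverses and
    factors below are all of this form. *)
Lemma geometric_cvg (V : completeNormedModType C) (u : nat -> V) (M r : R) :
  0 <= r -> r < 1 -> (forall n, rnorm (u n.+1 - u n) <= M * r ^+ n) ->
  exists l : V, u n @[n --> \oo] --> l.
Proof.
move=> r0 r1 uM; pose K := M / (1 - r).
have MK : M = K * (1 - r) by rewrite /K mulfVK ?gt_eqF ?subr_gt0.
have M0 : 0 <= M.
  by have := uM 0; have := rnorm_ge0 (u 1 - u 0); rewrite expr0; lra.
have K0 : 0 <= K by rewrite divr_ge0 ?subr_ge0// ltW.
have uK n m : rnorm (u (n + m)%N - u n) <= K * (r ^+ n - r ^+ (n + m)).
  elim: m => [|m IH]; first by rewrite addn0 !subrr mulr0 rnorm0.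
  have := rnormD (u (n + m).+1 - u (n + m)%N) (u (n + m)%N - u n).
  rewrite subrKA addnS exprS; have := uM (n + m)%N.
  by rewrite MK; nra.
have uK' n m : rnorm (u (n + m)%N - u n) <= K * r ^+ n.
  apply: le_trans (uK n m) _; rewrite ler_wpM2l// gerBl exprn_ge0//.
suff : cvg (u n @[n --> \oo]) by move=> /cvg_ex.
apply: cauchy_cvg; apply/cauchyP => e e0.
have re0 : 0 < complex.Re e by rewrite -ltcR RRe_real ?gtr0_real.
have r1' : `|r| < 1 by rewrite ger0_norm.
have /cvgrPdist_lt/(_ _ re0)[N _ NP] := cvg_geometric K r1'.
exists (u N); exists N => // n /= Nn.
rewrite -ball_normE/= distrC rnormE -[e]RRe_real ?gtr0_real// ltcR.
rewrite -(subnKC Nn); apply: le_lt_trans (uK' _ _) _.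
by have := NP N (leqnn N);
  rewrite /= sub0r normrN ger0_norm// mulr_ge0// exprn_ge0.
Qed.

End RealNorm.

(** * Linear identities as ring identities *)

Section LinearIdentities.
Variables (K : comNzRingType) (V : lmodType K).

(** The square-zero extension of [K] by [V]: since [v |-> (0, v)] is injective
    and turns scaling into a product, an identity between linear combinations
    in [V] becomes an identity in a commutative ring. *)
Definition sqz_ext : Type := (K * V)%type.
HB.instance Definition _ := GRing.Zmodule.on sqz_ext.

Let one : sqz_ext := (1, 0).
Let mul (x y : sqz_ext) : sqz_ext := (x.1 * y.1, x.1 *: y.2 + y.1 *: x.2).

Let mulA : associative mul.
Proof.
move=> x y z; congr pair; rewrite /= ?mulrA// !scalerDr !scalerA addrA.
by rewrite [y.1 * z.1]mulrC [z.1 * x.1]mulrC [z.1 * y.1]mulrC.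
Qed.

Let mulC : commutative mul.
Proof. by move=> x y; congr pair; [exact: mulrC|exact: addrC]. Qed.

Let mul1 : left_id one mul.
Proof.
by move=> [x v]; congr pair; rewrite /= ?mul1r// scale1r scaler0 addr0.
Qed.

Let mulDl : left_distributive mul +%R.
Proof.
move=> x y z; congr pair; rewrite /= ?mulrDl// scalerDl scalerDr.
by rewrite addrACA.
Qed.

Let one_neq0 : one != 0.
Proof. by rewrite xpair_eqE oner_eq0. Qed.

HB.instance Definition _ := GRing.Zmodule_isComNzRing.Build sqz_ext
  mulA mulC mul1 mulDl one_neq0.

Definition sqz_vec (v : V) : sqz_ext := (0, v).
Definition sqz_scal (c : K) : sqz_ext := (c, 0).

Lemma sqz_vec_inj : injective sqz_vec. Proof. by move=> v w []. Qed.

Lemma sqz_vecD v w : sqz_vec (v + w) = sqz_vec v + sqz_vec w.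
Proof. by congr pair; rewrite /= ?addr0. Qed.

Lemma sqz_vecN v : sqz_vec (- v) = - sqz_vec v.
Proof. by congr pair; rewrite /= ?oppr0. Qed.

Lemma sqz_vec0 : sqz_vec 0 = 0. Proof. by []. Qed.

Fact sqz_scal_additive : zmod_morphism sqz_scal.
Proof. by move=> v w; congr pair; rewrite /= ?subr0. Qed.
HB.instance Definition _ := GRing.isZmodMorphism.Build K sqz_ext sqz_scal
  sqz_scal_additive.

Fact sqz_scal_multiplicative : monoid_morphism sqz_scal.
Proof. by split=> // v w; congr pair; rewrite /= !scaler0 addr0. Qed.
HB.instance Definition _ := GRing.isMonoidMorphism.Build K sqz_ext sqz_scal
  sqz_scal_multiplicative.

Lemma sqz_vecZ c v : sqz_vec (c *: v) = sqz_scal c * sqz_vec v.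
Proof. by congr pair; rewrite /= ?mulr0// scale0r addr0. Qed.

End LinearIdentities.

Ltac lin_id :=
  apply: sqz_vec_inj; rewrite ?(sqz_vecD, sqz_vecN, sqz_vec0, sqz_vecZ); ring.

(** * C*-algebras and square roots near 1 *)

Section CStarBasics.
Variables (R : realType) (A : cstarType R).
Local Notation C := R[i].
Implicit Types a b c k h y : A.

Lemma amul0l a : 0 ** a = 0.
Proof. by apply: (addrI (0 ** a)); rewrite -amulDl !addr0. Qed.
Lemma amul0r a : a ** 0 = 0.
Proof. by apply: (addrI (a ** 0)); rewrite -amulDr !addr0. Qed.
Lemma amulNl a b : (- a) ** b = - (a ** b).
Proof. by rewrite -scaleN1r amulZl scaleN1r. Qed.
Lemma amulNr a b : a ** (- b) = - (a ** b).
Proof. by rewrite -scaleN1r amulZr scaleN1r. Qed.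
Lemma astar0 : astar (0 : A) = 0.
Proof. by apply: (addrI (astar (0 : A))); rewrite -astarD !addr0. Qed.
Lemma astarN a : astar (- a) = - astar a.
Proof. by rewrite -scaleN1r astarZ rmorphN1 scaleN1r. Qed.

Definition amulE := (@amulDl R A, @amulDr R A, amulNl, amulNr, @amulZl R A,
  @amulZr R A, amul0l, amul0r).
Definition astarE := (@astarD R A, astarN, @astarZ R A, astar0, @astarM R A,
  @astarK R A).

Lemma rnormM a b : rnorm (a ** b) <= rnorm a * rnorm b.
Proof. by rewrite -lecR rmorphM/= -!rnormE; exact: amul_norm. Qed.

Lemma rnorm_sq a : rnorm (astar a ** a) = rnorm a ^+ 2.
Proof.
by apply: complexI; rewrite -rnormE rmorphXn/= -rnormE; exact: astar_norm.
Qed.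

(** The C*-identity gives [|a|^2 <= |a^*| |a|]. *)
Lemma rnorm_star a : rnorm (astar a) = rnorm a.
Proof.
have le b : rnorm b <= rnorm (astar b).
  have [->|b0] := eqVneq b 0; first by rewrite astar0.
  have := rnormM (astar b) b; rewrite rnorm_sq expr2.
  by rewrite ler_pM2r ?rnorm_gt0.
by have := le (astar a); rewrite astarK => ale; apply/eqP; rewrite eq_le ale le.
Qed.

Lemma cvg_amull a (u : nat -> A) l : u n @[n --> \oo] --> l ->
  a ** u n @[n --> \oo] --> a ** l.
Proof.
apply: (lipschitz_cvg (f := amul a) (M := rnorm a)) => x y.
by rewrite -amulNr -amulDr rnormM.
Qed.

Lemma cvg_amulr a (u : nat -> A) l : u n @[n --> \oo] --> l ->
  u n ** a @[n --> \oo] --> l ** a.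
Proof.
apply: (lipschitz_cvg (f := amul^~ a) (M := rnorm a)) => x y /=.
by rewrite -amulNl -amulDl mulrC rnormM.
Qed.

Lemma cvg_astar (u : nat -> A) l : u n @[n --> \oo] --> l ->
  astar (u n) @[n --> \oo] --> astar l.
Proof.
apply: (lipschitz_cvg (f := @astar R A) (M := 1)) => x y /=.
by rewrite -astarN -astarD rnorm_star mul1r.
Qed.

Lemma scale_half (V : lmodType C) (x : V) : (2^-1)%:C%C *: (x + x) = x.
Proof.
have h : 2^-1 + 2^-1 = 1 :> R by lra.
by rewrite scalerDr -scalerDl -rmorphD/= h scale1r.
Qed.

(** The element [1 - y] is a square root of [1 - k], although the algebra has
    no unit. It is the fixed point of [y |-> (k + y^2) / 2], which halves
    distances on the ball of radius [1/2]; the iterates from [0] are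
    polynomials in [k] without constant term, whence the last three
    properties. This replaces the continuous functional calculus. *)
Lemma sqrt_one_minus (J : set A) k : ideal J -> J k -> astar k = k ->
  rnorm k <= 3 / 4 ->
  exists y, [/\ y + y = k + y ** y, astar y = y, J y &
    forall h, h ** k = k ** h -> h ** y = y ** h].
Proof.
move=> [J0 Jc Jl Jr] Jk ks k34.
have JD a b : J a -> J b -> J (a + b).
  by move=> Ja Jb; rewrite -[a]scale1r; apply: J0.2.
have JZ (c : C) a : J a -> J (c *: a).
  by move=> Ja; rewrite -[c *: a]addr0; apply: J0.2 => //; exact: J0.1.
(* The fixed points of f are the solutions of 2 y - y^2 = k. *)
pose f (y : A) : A := (2^-1)%:C%C *: (k + y ** y).
pose u n := iter n f 0.
have fdist x y : rnorm x <= 2^-1 -> rnorm y <= 2^-1 ->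
    rnorm (f x - f y) <= 2^-1 * rnorm (x - y).
  move=> x1 y1; have -> : f x - f y =
      (2^-1)%:C%C *: (x ** (x - y) + (x - y) ** y).
    by rewrite /f !amulE; lin_id.
  rewrite rnormZr ?invr_ge0// ler_wpM2l ?invr_ge0//.
  have := rnormD (x ** (x - y)) ((x - y) ** y).
  have := rnormM x (x - y); have := rnormM (x - y) y.
  have := rnorm_ge0 (x - y); nra.
have u1 n : rnorm (u n) <= 2^-1.
  elim: n => [|n IH]; first by rewrite /= rnorm0 invr_ge0.
  rewrite /= /f rnormZr ?invr_ge0//.
  have := rnormD k (u n ** u n); have := rnormM (u n) (u n).
  have := rnorm_ge0 (u n); rewrite /u; nra.
have [|||y uy] := @geometric_cvg R A u 1 2^-1; [lra|lra| |].
  elim=> [|n IH].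
    by rewrite expr0 mulr1 subr0; apply: le_trans (u1 1) _; lra.
  change (rnorm (f (u n.+1) - f (u n)) <= 1 * 2^-1 ^+ n.+1); rewrite exprS.
  by have := fdist _ _ (u1 n.+1) (u1 n); move: IH; lra.
have y1 : rnorm y <= 2^-1.
  by rewrite -[y]subr0; apply: cvg_rnorm_le uy _ => n; rewrite subr0.
have fy : f y = y.
  have /cvg_rnorm fuy : u n.+1 @[n --> \oo] --> f y.
    apply/cvg_rnorm => e e0; have [N NP] := (cvg_rnorm _ _).1 uy e e0.
    exists N => n /NP un; have := fdist _ _ (u1 n) y1.
    have := rnorm_ge0 (u n - y); rewrite -[u n.+1]/(f (u n)); lra.
  apply: (@cvg_rnorm_unique R A (fun n => u n.+1)); first exact/cvg_rnorm.
  by rewrite (cvg_shiftS u).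
exists y; split.
- by rewrite -{1 2}fy /f -scalerDr scale_half.
- apply: (@cvg_rnorm_unique R A u) => //.
  rewrite (_ : u = fun n => astar (u n)); first exact: cvg_astar.
  apply/funext; elim=> [|n IH]; first by rewrite astar0.
  by rewrite /= /f !astarE ks -/(u n) -IH; congr (_ *: _); symmetry;
    apply/CrealP; rewrite complex_real.
- apply: (closed_cvg _ Jc _ _ uy); apply: nearW; elim=> [|n IH];
    first exact: J0.1.
  by apply: JZ; apply: JD => //; exact: Jl.
- move=> h hk; apply: (@cvg_rnorm_unique R A (fun n => h ** u n));
    first exact: cvg_amull.
  rewrite (_ : (fun n => h ** u n) = fun n => u n ** h); first exact: cvg_amulr.
  apply/funext; elim=> [|n IH]; first by rewrite amul0l amul0r.
  by rewrite /= /f !amulE hk -/(u n) -amulA -IH !amulA IH.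
Qed.

End CStarBasics.
Arguments amulE {R A}.
Arguments astarE {R A}.

(** * Boundedness of representations *)

Section RepresentationBasics.
Variables (R : realType) (A : cstarType R) (H : hilbertType R).
Local Notation C := R[i].
Implicit Types (a b u q : A) (x y : H) (pi : representation A H).

Lemma ideal_setT : ideal [set: A].
Proof. by split=> //; exact: closedT. Qed.

Lemma ideal0 (J : set A) : ideal J -> J 0. Proof. by case=> -[]. Qed.

Lemma idealD (J : set A) a b : ideal J -> J a -> J b -> J (a + b).
Proof. by case=> -[_ JD] _ _ _ Ja Jb; rewrite -[a]scale1r; apply: JD. Qed.

Lemma idealZ (J : set A) (c : C) a : ideal J -> J a -> J (c *: a).
Proof. by case=> -[J0 JD] _ _ _ Ja; rewrite -[c *: a]addr0; apply: JD. Qed.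

Lemma idealN (J : set A) a : ideal J -> J a -> J (- a).
Proof. by move=> Jid Ja; rewrite -scaleN1r; apply: idealZ. Qed.

Lemma idealB (J : set A) a b : ideal J -> J a -> J b -> J (a - b).
Proof. by move=> Jid Ja Jb; apply: idealD => //; exact: idealN. Qed.

Lemma repD pi a b x : pi (a + b) x = pi a x + pi b x.
Proof. by have := rep_linear pi 1 a b x; rewrite !scale1r. Qed.

Lemma rep0 pi x : pi 0 x = 0.
Proof. by apply: (addrI (pi 0 x)); rewrite -repD !addr0. Qed.

Lemma repZ pi (c : C) a x : pi (c *: a) x = c *: pi a x.
Proof. by have := rep_linear pi c a 0 x; rewrite addr0 rep0 addr0. Qed.

Lemma repN pi a x : pi (- a) x = - pi a x.
Proof. by rewrite -scaleN1r repZ scaleN1r. Qed.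

Definition repE := (repD, repN, repZ, rep0, @rep_amul R A H).
Lemma bopD (T : bop H) x y : T (x + y) = T x + T y. Proof. exact: linearD. Qed.
Lemma bopN (T : bop H) x : T (- x) = - T x. Proof. exact: linearN. Qed.
Lemma bopZ (T : bop H) (c : C) x : T (c *: x) = c *: T x.
Proof. exact: linearZ. Qed.
Lemma bop0 (T : bop H) : T 0 = 0. Proof. exact: linear0. Qed.
Definition opE := (bopD, bopN, bopZ, bop0).

Lemma inner_conj x y : inner x y = (inner y x)^*.
Proof. by rewrite (hermC inner) expr0 mul1r. Qed.

Lemma rep_inner pi a x y : inner (pi a x) y = inner x (pi (astar a) y).
Proof. by rewrite -[a in LHS]astarK; exact: rep_astar. Qed.

Lemma inner_rnorm x : inner x x = (rnorm x ^+ 2)%:C%C.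
Proof. by rewrite inner_norm rnormE rmorphXn. Qed.

Lemma rnorm_inner x y : inner x x = inner y y -> rnorm x = rnorm y.
Proof.
rewrite !inner_rnorm => /complexI xy.
by apply/eqP; rewrite -(@eqrXn2 _ 2) ?rnorm_ge0// xy.
Qed.

(** The family [F a] behaves like [pi(a) x0] as far as inner products can
    tell, and nothing more is assumed, so that the bound applies before a
    representation is known to exist. If [1 - y] is the square root of [1 -
    b^* b], then [|x0 - F y|^2 = |x0|^2 - |F b|^2], and the left side is
    nonnegative. *)
Lemma gram_bound (F : A -> H) (x0 : H) :
  (forall a b, F (a + b) = F a + F b) ->
  (forall (c : C) a, F (c *: a) = c *: F a) ->
  (forall a, inner (F a) x0 = inner x0 (F (astar a))) ->
  (forall a b, inner (F a) (F b) = inner x0 (F (astar a ** b))) ->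
  forall a, rnorm (F a) <= 2 * rnorm a * rnorm x0.
Proof.
move=> FD FZ F0 FF a.
have small b : rnorm b = 2^-1 -> rnorm (F b) <= rnorm x0.
  move=> b2; pose k := astar b ** b.
  have [||y [yE ys _ _]] := @sqrt_one_minus R A _ k ideal_setT I.
  - by rewrite !astarE.
  - by rewrite rnorm_sq b2; lra.
  have : inner (x0 - F y) (x0 - F y) = inner x0 x0 - inner (F b) (F b).
    have yx0 : inner x0 (F y) = (inner x0 (F y))^* by rewrite -inner_conj F0 ys.
    rewrite dnormB -yx0 -(linearDr inner) -FD yE FF FD linearDr /= !FF ys.
    by rewrite opprD addrA addrAC; ring.
  rewrite !inner_rnorm -rmorphB/= => /complexI E.
  rewrite -(@ler_pXn2r _ 2) ?nnegrE ?rnorm_ge0// -subr_ge0 -E.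
  by rewrite sqr_ge0.
have [->|a0] := eqVneq a 0.
  have -> : F 0 = 0 by rewrite -(scale0r 0) FZ scale0r.
  by rewrite !rnorm0 mulr0 mul0r.
(* Rescaling a to norm 1/2 makes the previous case apply. *)
have na := rnorm_gt0 a0; pose t := (2 * rnorm a)^-1.
have t0 : 0 <= t by rewrite invr_ge0 mulr_ge0 ?rnorm_ge0.
have := small (t%:C%C *: a); rewrite FZ !rnormZr//.
rewrite {1}/t invfM mulfVK ?gt_eqF// => /(_ erefl).
by rewrite /t mulrC ler_pdivrMr ?mulr_gt0// mulrC.
Qed.

Lemma rep_bound pi a x : rnorm (pi a x) <= 2 * rnorm a * rnorm x.
Proof.
apply: (gram_bound (F := fun a => pi a x)) => [b c|c b|b|b c].
- exact: repD.
- exact: repZ.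
- exact: rep_inner.
- by rewrite rep_inner rep_amul.
Qed.

End RepresentationBasics.
Arguments repE {R A H}.
Arguments opE {R H}.

(** * Approximate units from averaged unitaries *)

Section ApproximateUnit.
Variables (R : realType) (A : cstarType R) (H : hilbertType R).
Variables (pi : representation A H) (J : set A).
Hypothesis Jid : ideal J.
Local Notation C := R[i].
Implicit Types (a b h u p q : A) (x y : H).

(** The formal element [1 + p] acts isometrically on the algebra and on the
    Hilbert space. *)
Definition plus1_isometry p : Prop :=
  [/\ J p, forall b, rnorm (b + p ** b) = rnorm b &
      forall x, rnorm (x + pi p x) = rnorm x].

(** The formal element [1 - u] acts contractively on the algebra and on the
    Hilbert space. Such elements are the members of an approximate unit of
    [J]. *)
Definition minus1_contraction u : Prop :=
  [/\ J u, forall b, rnorm (b - u ** b) <= rnorm b &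
      forall x, rnorm (x - pi u x) <= rnorm x].

Lemma plus1_unitary_isometry q : J q -> q + astar q + astar q ** q = 0 ->
  plus1_isometry q.
Proof.
move=> Jq qE; split=> // [b|x].
  apply/eqP; rewrite -(@eqrXn2 _ 2) ?rnorm_ge0// -!rnorm_sq; apply/eqP;
    congr rnorm.
  rewrite !(astarE, amulE);
    transitivity (astar b ** b + astar b ** (q + astar q + astar q ** q) ** b).
    by rewrite !amulE !amulA; lin_id.
  by rewrite qE !amulE addr0.
apply: rnorm_inner; rewrite dnormD -inner_conj.
have -> : inner (pi q x) (pi q x) = inner x (pi (astar q ** q) x).
  by rewrite rep_inner rep_amul.
rewrite [inner (pi q x) x]rep_inner.
have : inner x (pi (q + astar q + astar q ** q) x) = 0.
  by rewrite qE rep0 linear0r.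
rewrite !repD !linearDr/= => E.
by rewrite -addrA [X in _ + X]addrC E addr0.
Qed.

Lemma plus1_isometry_mul p q : plus1_isometry p -> plus1_isometry q ->
  plus1_isometry (p + q + p ** q).
Proof.
move=> [Jp pb px] [Jq qb qx]; split=> [|b|x].
- by apply: idealD => //; [exact: idealD|case: Jid => _ _ Jl _; exact: Jl].
- rewrite -[RHS]qb -[RHS]pb !amulE amulA; congr rnorm; lin_id.
- rewrite -[RHS]qx -[RHS]px !repE !opE; congr rnorm; lin_id.
Qed.

(** Apply the isometry to [p^*] and use [|p p^*| = |p|^2]. *)
Lemma plus1_isometry_norm p : plus1_isometry p -> rnorm p <= 2.
Proof.
case=> _ pb _; have [->|p0] := eqVneq p 0; first by rewrite rnorm0.
have := rnormB (astar p + p ** astar p) (astar p).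
rewrite pb addrAC subrr add0r -{1}(astarK p) rnorm_sq rnorm_star.
have := rnorm_gt0 p0; nra.
Qed.

Lemma minus1_contraction_norm u : minus1_contraction u -> rnorm u <= 2.
Proof.
case=> _ ub _; have [->|u0] := eqVneq u 0; first by rewrite rnorm0.
have := rnormB (astar u) (astar u - u ** astar u).
rewrite opprB addrC subrK -{1}(astarK u) rnorm_sq.
have := ub (astar u); rewrite rnorm_star.
have := rnorm_gt0 u0; nra.
Qed.

Lemma minus1_contraction0 : minus1_contraction 0.
Proof.
by split=> [|b|x]; rewrite ?amul0l ?rep0 ?subr0//; exact: ideal0.
Qed.

(** The element in question is [1 - (1 - u) (1 - v)]. *)
Lemma minus1_contraction_mul u v : minus1_contraction u ->
  minus1_contraction v ->
  minus1_contraction (u + v - u ** v).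
Proof.
move=> [Ju ub ux] [Jv vb vx]; split=> [|b|x].
- by apply: idealB => //; [exact: idealD|case: Jid => _ _ Jl _; exact: Jl].
- apply: le_trans (vb b); apply: le_trans (ub _); rewrite !amulE amulA le_eqVlt.
  by apply/orP; left; apply/eqP; congr rnorm; lin_id.
- apply: le_trans (vx x); apply: le_trans (ux _); rewrite !repE !opE le_eqVlt.
  by apply/orP; left; apply/eqP; congr rnorm; lin_id.
Qed.

(** With [1 - y] the square root of [1 - h^2], the formal element [1 + q = (1
    - y) + i h] is unitary, and [h] is its imaginary part. *)
Lemma selfadjoint_unitary h : J h -> astar h = h -> rnorm h <= 2^-1 ->
  exists q, [/\ J q, q + astar q + astar q ** q = 0,
    q + astar q + q ** astar q = 0 & q - astar q = 'i *: (h + h)].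
Proof.
move=> Jh hs h1.
have [|||y [yE ys Jy yc]] := @sqrt_one_minus R A J (h ** h) Jid.
- by case: Jid => _ _ Jl _; exact: Jl.
- by rewrite astarM hs.
- by rewrite -{1}hs rnorm_sq; have := rnorm_ge0 h; nra.
have {}yc : h ** y = y ** h by apply: yc; rewrite amulA.
have qs : astar (- y + 'i *: h) = - y - 'i *: h.
  by rewrite !astarE ys hs conjCi scaleNr.
have ii : 'i * 'i = -1 :> C by rewrite -expr2 sqrCi.
exists (- y + 'i *: h); split.
- by apply: idealD => //; [exact: idealN|exact: idealZ].
- rewrite qs !amulE yc !scalerA; transitivity (h ** h + y ** y - (y + y));
    last by rewrite -yE subrr.
  by rewrite ?scalerN ?scalerA ii; lin_id.
- rewrite qs !amulE yc; transitivity (h ** h + y ** y - (y + y));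
    last by rewrite -yE subrr.
  by rewrite ?scalerN ?scalerA ii; lin_id.
- by rewrite qs; lin_id.
Qed.

(** Mean ergodic theorem: take [1 - u] to be the average of the powers [(1 +
    q)^k] for [k <= n]. It is an average of isometries, and its product with
    [q] telescopes to [((1 + q)^(n+1) - 1) / (n + 1)]. *)
Lemma averaged_powers q n : plus1_isometry q -> exists u,
  minus1_contraction u /\ rnorm (q - u ** q) <= 2 / n.+1%:R.
Proof.
move=> q_iso.
(* p = (1 + q)^(n+1) - 1 and n.+1 + S = \sum_(k <= n) (1 + q)^k. *)
have [p [S [p_iso SJ Sb Sx Sq]]] : exists p S, [/\ plus1_isometry p, J S,
    forall b, rnorm (n.+1%:R *: b + S ** b) <= n.+1%:R * rnorm b,
    forall x, rnorm (n.+1%:R *: x + pi S x) <= n.+1%:R * rnorm x &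
    n.+1%:R *: q + S ** q = p].
  elim: n => [|n [p [S [p_iso SJ Sb Sx Sq]]]].
    exists q, 0; split=> [||b|x|];
      rewrite ?scale1r ?amul0l ?rep0 ?addr0 ?mul1r//.
    exact: ideal0.
  exists (p + q + p ** q), (S + p); split.
  - exact: plus1_isometry_mul.
  - by apply: idealD => //; case: p_iso.
  - move=> b; rewrite amulDl -[n.+2]addn1 natrD scalerDl scale1r addrACA.
    rewrite natrD mulrDl mul1r.
    apply: le_trans (rnormD _ _) _; rewrite lerD ?Sb//.
    by case: p_iso => _ -> _.
  - move=> x; rewrite repD -[n.+2]addn1 natrD scalerDl scale1r addrACA.
    rewrite natrD mulrDl mul1r.
    apply: le_trans (rnormD _ _) _; rewrite lerD ?Sx//.
    by case: p_iso => _ _ ->.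
  - rewrite amulDl -[n.+2]addn1 natrD scalerDl scale1r addrACA Sq.
    by rewrite addrA.
pose t : R := n.+1%:R^-1.
have t0 : 0 <= t by rewrite invr_ge0.
have tn : t * n.+1%:R = 1 by rewrite mulVf// pnatr_eq0.
have tnC (V : lmodType C) (v : V) : v = t%:C%C *: (n.+1%:R *: v).
  by rewrite scalerA -(rmorph_nat (real_complex R)) -rmorphM/= tn scale1r.
exists (- (t%:C%C *: S)); split; first split.
- by apply: idealN => //; exact: idealZ.
- move=> b; rewrite amulNl opprK amulZl {1}(tnC _ b) -scalerDr rnormZr//.
  by apply: le_trans (ler_wpM2l t0 (Sb b)) _; rewrite mulrA tn mul1r.
- move=> x; rewrite repN opprK repZ {1}(tnC _ x) -scalerDr rnormZr//.
  by apply: le_trans (ler_wpM2l t0 (Sx x)) _; rewrite mulrA tn mul1r.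
- rewrite amulNl opprK amulZl {1}(tnC _ q) -scalerDr rnormZr// Sq mulrC.
  by rewrite ler_wpM2r// plus1_isometry_norm.
Qed.

(** As [h] is the imaginary part of a unitary [1 + q], it suffices to make [(1
    - u) q] small; then [(1 - u) q^*] is small as well, because [q^* = - (q +
    q q^* )]. *)
Lemma selfadjoint_approx_unit h (e : R) : J h -> astar h = h ->
  rnorm h <= 2^-1 -> 0 < e ->
  exists u, minus1_contraction u /\ rnorm (h - u ** h) <= e.
Proof.
move=> Jh hs h1 e0; have [q [Jq qsq qqs qh]] := selfadjoint_unitary Jh hs h1.
have q_iso := plus1_unitary_isometry Jq qsq.
pose n := Num.truncn (4 / e).
have ne : 4 / e < n.+1%:R by exact: truncnS_gt.
have [u [u_contr uq]] := averaged_powers n q_iso; exists u; split=> //.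
have hE : h - u ** h =
    (2^-1)%:C%C *: (- 'i *: ((q - u ** q) - (astar q - u ** astar q))).
  transitivity ((2^-1)%:C%C *: (- 'i *: ((q - astar q) - u ** (q - astar q)))).
    have ii : - 'i * 'i = 1 :> C by rewrite mulNr -expr2 sqrCi opprK.
    rewrite qh amulZr -scalerBr [- 'i *: _]scalerA ii scale1r amulDr.
    by rewrite -[LHS]scale_half; congr (_ *: _); lin_id.
  by rewrite !amulE; congr (_ *: (_ *: _)); lin_id.
have qsE : astar q - u ** astar q = - ((q - u ** q) + (q - u ** q) ** astar q).
  have qs : astar q = - (q + q ** astar q).
    by apply/eqP; rewrite -addr_eq0 addrCA addrA qqs.
  by rewrite {1 2}qs !amulE !amulA; lin_id.
have {}uq : rnorm (q - u ** q) <= e / 2.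
  apply: le_trans uq _; rewrite ler_pdivrMr//; move: ne; rewrite ltr_pdivrMr//.
  lra.
have i1 (z : A) : rnorm (- 'i *: z) = rnorm z by rewrite scaleNr rnormN rnormZi.
rewrite hE rnormZr ?invr_ge0// i1 qsE.
have := rnormB (q - u ** q) (- ((q - u ** q) + (q - u ** q) ** astar q)).
have := rnormD (q - u ** q) ((q - u ** q) ** astar q).
have := rnormM (q - u ** q) (astar q).
have := ler_wpM2l (rnorm_ge0 (q - u ** q)) (plus1_isometry_norm q_iso).
rewrite !rnormN rnorm_star.
lra.
Qed.

(** Reduces to the self-adjoint element [k = a a^*], because [|(1 - u) a|^2 =
    |(1 - u) k (1 - u)^*|]. *)
Lemma approx_unit a (e : R) : J a -> 0 < e ->
  exists u, minus1_contraction u /\ rnorm (a - u ** a) <= e.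
Proof.
move=> Ja e0; pose k := a ** astar a.
pose s := (2 * (rnorm k + 1))^-1.
have s0 : 0 < s by rewrite invr_gt0 mulr_gt0// ltr_wpDl ?rnorm_ge0.
have [||||u [u_contr uk]] :=
  @selfadjoint_approx_unit (s%:C%C *: k) (s * e ^+ 2 / 3).
- by apply: idealZ => //; case: Jid => _ _ _; exact.
- rewrite !astarE; congr (_ *: _); apply/CrealP; rewrite complex_real//.
- rewrite rnormZr; last exact: ltW.
  rewrite mulrC /s ler_pdivrMr.
    by have := rnorm_ge0 k; lra.
  by rewrite mulr_gt0// ltr_wpDl ?rnorm_ge0.
- by rewrite divr_gt0// mulr_gt0// exprn_gt0.
exists u; split=> //.
have {}uk : rnorm (k - u ** k) <= e ^+ 2 / 3.
  move: uk; rewrite amulZr -scalerBr rnormZr; last exact: ltW.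
  by rewrite -mulrA ler_pM2l.
rewrite -(@ler_pXn2r _ 2) ?nnegrE ?rnorm_ge0//; last exact: ltW.
rewrite -rnorm_star -rnorm_sq astarK.
have -> : (a - u ** a) ** astar (a - u ** a) =
  (k - u ** k) - (k - u ** k) ** astar u.
  by rewrite !(astarE, amulE) !amulA; lin_id.
have := rnormB (k - u ** k) ((k - u ** k) ** astar u).
have := rnormM (k - u ** k) (astar u).
have := minus1_contraction_norm u_contr; rewrite rnorm_star.
have := rnorm_ge0 (k - u ** k); have := rnorm_ge0 u; nra.
Qed.

End ApproximateUnit.

(** * Approximately fixed vectors and positive shifts *)

Section Factorization.
Variables (R : realType) (A : cstarType R) (H : hilbertType R).
Variables (pi : representation A H) (J : set A).
Hypotheses (Jid : ideal J) (Jstar : forall a, J a -> J (astar a)).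
Local Notation C := R[i].
Implicit Types (a b h u p q : A) (x y v w : H).

Local Notation contr := (minus1_contraction pi J).

(** The quantification over [u0] makes the property stable under sums: after
    [u1] has been found for the first summand, [u2] is sought for the second
    summand already multiplied by [(1 - u1) (1 - u0)]. *)
Definition unit_approximable v : Prop :=
  forall u0 (e : R), contr u0 -> 0 < e ->
  exists2 u, contr u & rnorm ((v - pi u0 v) - pi u (v - pi u0 v)) <= e.

Lemma unit_approximable_rep a x : J a -> unit_approximable (pi a x).
Proof.
move=> Ja u0 e u0c e0; pose r := 2 * (rnorm x + 1).
have r0 : 0 < r by rewrite mulr_gt0// ltr_wpDl ?rnorm_ge0.
have J' : J (a - u0 ** a).
  by apply: idealB => //; case: Jid => _ _ Jl _; exact: Jl.
have [|u [uc ua]] := @approx_unit R A H pi J Jid _ (e / r) J'.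
  by rewrite divr_gt0.
exists u => //.
have -> : pi a x - pi u0 (pi a x) - pi u (pi a x - pi u0 (pi a x)) =
    pi ((a - u0 ** a) - u ** (a - u0 ** a)) x.
  by rewrite !repE !opE.
apply: le_trans (rep_bound _ _ _) _; move: ua; rewrite ler_pdivlMr// /r.
have := rnorm_ge0 (a - u0 ** a - u ** (a - u0 ** a)); have := rnorm_ge0 x; nra.
Qed.

Lemma unit_approximableD v w : unit_approximable v -> unit_approximable w ->
  unit_approximable (v + w).
Proof.
move=> vP wP u0 e u0c e0; have e20 : 0 < e / 2 by rewrite divr_gt0.
have [u1 u1c u1v] := vP u0 _ u0c e20.
have [u2 u2c u2w] := wP _ _ (minus1_contraction_mul Jid u1c u0c) e20.
exists (u2 + u1 - u2 ** u1); first exact: minus1_contraction_mul.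
(* T u is the action of 1 - u. *)
pose T (u : A) (z : H) := z - pi u z.
have TD u z z' : T u (z + z') = T u z + T u z' by rewrite /T !opE; lin_id.
have TM u u' z : T (u + u' - u ** u') z = T u (T u' z).
  by rewrite /T !repE !opE; lin_id.
rewrite -/(T u0 _) -/(T _ (T u0 _)) TM.
rewrite (TD u0 v w) (TD u1 (T u0 v)) (TD u2 (T u1 (T u0 v))).
apply: le_trans (rnormD _ _) _; rewrite [leRHS]splitr lerD//.
  by case: u2c => _ _ u2x; exact: le_trans (u2x (T u1 (T u0 v))) u1v.
by move: u2w; rewrite -/(T _ w) TM.
Qed.

Lemma unit_approximableZ (c : C) v : unit_approximable v ->
  unit_approximable (c *: v).
Proof.
move=> vP u0 e u0c e0; pose r := complex.Re `|c| + 1.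
have c0 : 0 <= complex.Re `|c|.
  by rewrite -lecR RRe_real ?normr_real//; exact: normr_ge0.
have r0 : 0 < r by rewrite ltr_wpDl.
have [|u uc uv] := vP u0 (e / r) u0c; first by rewrite divr_gt0.
exists u => //; rewrite (bopZ (pi u0)) -scalerBr (bopZ (pi u)) -scalerBr rnormZ.
move: uv; rewrite ler_pdivlMr// /r.
have := rnorm_ge0 (v - pi u0 v - pi u (v - pi u0 v)); nra.
Qed.

Lemma unit_approximable_closure v :
  closure (lin_span [set y | exists a x, J a /\ y = pi a x]) v ->
  unit_approximable v.
Proof.
move=> vW; have spanP y :
    lin_span [set y | exists a x, J a /\ y = pi a x] y -> unit_approximable y.
  case=> n [c [x [xP ->]]]; elim: n => [|n IH] in c x xP *.
    by rewrite big_ord0 -(rep0 pi 0); apply: unit_approximable_rep;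
      exact: ideal0.
  rewrite big_ord_recl; apply: unit_approximableD.
    apply: unit_approximableZ; have [a [z [Ja ->]]] := xP ord0.
    exact: unit_approximable_rep.
  by apply: IH => i; exact: xP.
move=> u0 e u0c e0; have e20 : 0 < e / 2 by rewrite divr_gt0.
have [y yW vy] := (closure_rnorm _ _).1 vW _ e20.
have [u uc uy] := spanP y yW u0 _ u0c e20; exists u => //.
have -> : v - pi u0 v - pi u (v - pi u0 v) =
  ((v - y) - pi u0 (v - y) - pi u ((v - y) - pi u0 (v - y))) +
  (y - pi u0 y - pi u (y - pi u0 y)) by rewrite !opE; lin_id.
apply: le_trans (rnormD _ _) _; rewrite [leRHS]splitr lerD//.
apply: le_trans (ltW vy); case: u0c => _ _ u0c.
by case: uc => _ _ ux; exact: le_trans (ux _) (u0c _).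
Qed.

(** If [1 - u] is contractive, then [1 - (1 - u)^* (1 - u)] is a positive
    operator, and it moves [v] as little as [u] does. *)
Lemma positive_approx_unit v (e : R) : unit_approximable v -> 0 < e ->
  exists u, [/\ J u, rnorm u <= 8, forall x, 0 <= inner (pi u x) x &
    rnorm (v - pi u v) <= e].
Proof.
move=> vP e0; have [|u uc] := vP 0 (e / 5) (minus1_contraction0 pi Jid).
  by rewrite divr_gt0.
rewrite rep0 subr0 => uv; have u2 := minus1_contraction_norm uc.
case: uc => Ju _ ux; have Jus := Jstar Ju.
exists (u + astar u - astar u ** u); split.
- by apply: idealB => //; [exact: idealD|case: Jid => _ _ _; exact].
- have := rnormB (u + astar u) (astar u ** u); have := rnormD u (astar u).
  rewrite rnorm_sq rnorm_star; have := rnorm_ge0 u; nra.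
- move=> x; rewrite !repE.
  have -> : inner (pi u x + pi (astar u) x - pi (astar u) (pi u x)) x =
      inner x x - inner (x - pi u x) (x - pi u x).
    rewrite dnormB -inner_conj (linearBl inner) (linearDl inner)/=.
    rewrite [inner (pi (astar u) x) x]rep_inner astarK.
    rewrite [inner (pi (astar u) _) x]rep_inner astarK.
    ring.
  rewrite !inner_rnorm -rmorphB/= (lecR 0) subr_ge0.
  by rewrite ler_pXn2r ?nnegrE ?rnorm_ge0.
- have -> : v - pi (u + astar u - astar u ** u) v =
    (v - pi u v) - pi (astar u) (v - pi u v) by rewrite !repE !opE; lin_id.
  have := rnormB (v - pi u v) (pi (astar u) (v - pi u v)).
  have := rep_bound pi (astar u) (v - pi u v); rewrite rnorm_star.
  have := rnorm_ge0 (v - pi u v); nra.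
Qed.

(** Here [p] is the inner product itself, which is real by hypothesis. *)
Lemma rnorm_comb x y : 0 <= inner y x -> exists2 p : R, 0 <= p &
  forall s t : R, rnorm (s%:C%C *: x + t%:C%C *: y) ^+ 2 =
    s ^+ 2 * rnorm x ^+ 2 + 2 * s * t * p + t ^+ 2 * rnorm y ^+ 2.
Proof.
move=> yx; exists (complex.Re (inner y x)).
  by rewrite -lecR RRe_real ?ger0_real.
have : inner y x = (complex.Re (inner y x))%:C%C by rewrite RRe_real ?ger0_real.
set p := complex.Re (inner y x) => yxE s t; apply: complexI.
have conjR (r : R) : (r%:C%C)^* = r%:C%C by apply/CrealP; rewrite complex_real.
rewrite -inner_rnorm.
transitivity (s%:C%C * (s%:C%C * (rnorm x ^+ 2)%:C%C) +
  t%:C%C * (t%:C%C * (rnorm y ^+ 2)%:C%C) +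
  (t%:C%C * (s%:C%C * p%:C%C) + s%:C%C * (t%:C%C * p%:C%C))).
  rewrite dnormD -inner_conj !(linearZl_LR, linearZr_LR)/=.
  by rewrite [inner x y]inner_conj yxE !conjR !inner_rnorm.
by rewrite -!(rmorphM (real_complex R)) -!(rmorphD (real_complex R));
  congr (_%:C)%C; ring.
Qed.

Lemma positive_shift_lower b (d : R) x : 0 <= d -> 0 <= inner (pi b x) x ->
  d * rnorm x <= rnorm (pi b x + d%:C%C *: x).
Proof.
move=> d0 /rnorm_comb[p p0 /(_ d 1)].
rewrite scale1r expr1n mulr1 mul1r addrC => E.
rewrite -(@ler_pXn2r _ 2) ?nnegrE ?mulr_ge0 ?rnorm_ge0// E exprMn.
have := rnorm_ge0 (pi b x); nra.
Qed.

(** The operator [b + d] is accretive with lower bound [d], so [w |-> w - t (b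
    w + d w - v)] is a strict contraction once [t] is small; its fixed point
    solves the equation. *)
Lemma positive_shift_surj b (d : R) v : (forall x, 0 <= inner (pi b x) x) ->
  0 < d -> exists w, pi b w + d%:C%C *: w = v.
Proof.
(* |(1 - t d) x - t b x|^2 <= ((1 - t d)^2 + t^2 B^2) |x|^2, which equals
   (1 - t d) |x|^2 for this t; r bounds the square root of 1 - t d. *)
move=> bpos d0; pose B := 2 * rnorm b; pose t := d / (d ^+ 2 + B ^+ 2).
have B0 : 0 <= B by rewrite mulr_ge0 ?rnorm_ge0.
have D0 : 0 < d ^+ 2 + B ^+ 2 by rewrite ltr_pwDl ?exprn_gt0 ?sqr_ge0.
have t0 : 0 < t by rewrite divr_gt0.
have tD : t * (d ^+ 2 + B ^+ 2) = d by rewrite /t mulfVK ?gt_eqF.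
have td1 : t * d <= 1.
  by rewrite /t mulrAC ler_pdivrMr// mul1r -expr2 lerDl sqr_ge0.
clearbody t; pose r := 1 - t * d / 2.
have td0 : 0 < t * d by rewrite mulr_gt0.
pose g w := w - t%:C%C *: (pi b w + d%:C%C *: w - v).
have g_lip w w' : rnorm (g w - g w') <= r * rnorm (w - w').
  have -> : g w - g w' = (1 - t * d)%:C%C *: (w - w') + (- t)%:C%C *: pi b (w -
    w').
    by rewrite /g !opE (rmorphB (real_complex R)) (rmorphN (real_complex R))
      (rmorphM (real_complex R)) (rmorph1 (real_complex R)); lin_id.
  have [p p0 E] := rnorm_comb (bpos (w - w')).
  rewrite -(@ler_pXn2r _ 2) ?nnegrE ?mulr_ge0 ?rnorm_ge0//; last by rewrite /r;
    lra.
  rewrite E exprMn; have := rep_bound pi b (w - w'); rewrite -/B => bB.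
  have {}bB : rnorm (pi b (w - w')) ^+ 2 <= B ^+ 2 * rnorm (w - w') ^+ 2.
    by rewrite -exprMn ler_pXn2r ?nnegrE ?mulr_ge0 ?rnorm_ge0.
  have {}bB := ler_wpM2l (sqr_ge0 t) bB.
  have p' : 0 <= (1 - t * d) * t * p by rewrite !mulr_ge0 ?subr_ge0//;
    exact: ltW.
  have n0 : 0 <= rnorm (w - w') ^+ 2 by rewrite sqr_ge0.
  have rE : (1 - t * d) ^+ 2 + t ^+ 2 * B ^+ 2 = 1 - t * d.
    transitivity (1 - 2 * (t * d) + t * (t * (d ^+ 2 + B ^+ 2))); first by ring.
    by rewrite tD; ring.
  have r2 : 1 - t * d <= r ^+ 2 by rewrite /r; nra.
  have := ler_wpM2r n0 r2; rewrite -{1}rE; clearbody r; nra.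
pose u n := iter n g 0.
have [|||w uw] := @geometric_cvg R H u (rnorm (u 1%N - u 0%N)) r.
- by rewrite /r; lra.
- by rewrite /r; lra.
- elim=> [|n IH]; first by rewrite expr0 mulr1.
  apply: le_trans (g_lip (u n.+1) (u n)) _; rewrite exprS mulrCA ler_wpM2l//.
  by rewrite /r; lra.
have gw : g w = w.
  apply: (@cvg_rnorm_unique R H (fun n => u n.+1));
    last by rewrite (cvg_shiftS u).
  exact: (lipschitz_cvg g_lip uw).
exists w; apply/eqP; rewrite -subr_eq0; apply/eqP.
apply: (@scalerI _ _ t%:C%C);
  first by rewrite -(rmorph0 (real_complex R)) (inj_eq (@complexI _)) gt_eqF.
by rewrite scaler0; apply: oppr_inj; apply: (addrI w); rewrite oppr0 addr0;
  exact: gw.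
Qed.

End Factorization.

(** * Cohen factorization *)

Lemma indexed_dependent_choice (T : Type) (P : nat -> T -> Prop)
    (Q : nat -> T -> T -> Prop) (t0 : T) : P 0%N t0 ->
  (forall n t, P n t -> exists2 t', P n.+1 t' & Q n t t') ->
  exists f : nat -> T, [/\ f 0%N = t0, forall n, P n (f n) &
    forall n, Q n (f n) (f n.+1)].
Proof.
move=> P0 step.
pose next n (t : {t | P n t}) : {t | P n.+1 t} :=
  let: exist2 t' Pt' _ := cid2 (step n (sval t) (svalP t)) in exist _ t' Pt'.
pose F := fix F n : {t | P n t} :=
  if n is m.+1 then next m (F m) else exist _ t0 P0.
exists (fun n => sval (F n)); split=> // n; first exact: svalP.
by rewrite /= /next; case: cid2.
Qed.

Section Cohen.
Variables (R : realType) (A : cstarType R) (H : hilbertType R).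
Variables (pi : representation A H) (J : set A).
Hypotheses (Jid : ideal J) (Jstar : forall a, J a -> J (astar a)).
Local Notation C := R[i].

Lemma half_pow_cvg0 (e : R) : 0 < e ->
  exists N, forall n, (N <= n)%N -> 2^-1 ^+ n < e.
Proof.
move=> e0; have h1 : `|2^-1 : R| < 1 by rewrite ger0_norm ?invr_ge0//; lra.
have /cvgrPdist_lt/(_ _ e0)[N _ NP] := cvg_geometric 1 h1.
exists N => n Nn; have := NP n Nn.
by rewrite /= sub0r normrN mul1r ger0_norm ?exprn_ge0 ?invr_ge0.
Qed.

(** Put [T_n = b_n + 2^(-n)] with [b_n = sum_(1 <= k <= n) 2^(-k) u_k], where
    the [u_k] are positive and uniformly bounded, and [w_n = T_n^(-1) v]. From
    [T_(n+1) (w_(n+1) - w_n) = 2^(-n-1) (1 - u_(n+1)) w_n] and [|T_(n+1) x| >=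
    2^(-n-1) |x|] one gets [|w_(n+1) - w_n| <= |(1 - u_(n+1)) w_n|], which is
    at most [2^(-n)] if [u_(n+1)] is chosen after [w_n]. In the limit [v =
    pi(b) w]. Positivity is what makes a unit on the single vector [w_n]
    enough. *)
Lemma cohen_factorization v : unit_approximable pi J v ->
  exists b w, J b /\ v = pi b w.
Proof.
move=> vP; pose d n : R := 2^-1 ^+ n.
have d0 n : 0 < d n by rewrite exprn_gt0// invr_gt0.
have dS n : d n = d n.+1 + d n.+1 by rewrite /d exprS; lra.
(* A state is a pair (b_n, w_n) with b_n positive and T_n w_n = v. *)
pose P n (t : A * H) := [/\ J t.1, forall x, 0 <= inner (pi t.1 x) x &
  pi t.1 t.2 + (d n)%:C%C *: t.2 = v].
pose Q n (t t' : A * H) := rnorm (t'.1 - t.1) <= 8 * d n /\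
  rnorm (t'.2 - t.2) <= 1 * d n.
have [|n [b w] [/= Jb bpos bw]|f [_ fP fQ]] :=
  @indexed_dependent_choice _ P Q (0, v).
- split=> /= [|x|]; first exact: ideal0.
    by rewrite rep0 linear0l.
  by rewrite rep0 /d expr0 scale1r add0r.
(* w = 2^n (v - pi b w) inherits approximability from v and pi b w. *)
- have wP : unit_approximable pi J w.
    have dd : ((d n)^-1)%:C%C * (d n)%:C%C = 1 :> C.
      by rewrite -(rmorphM (real_complex R)) mulVf ?gt_eqF.
    have -> : w = ((d n)^-1)%:C%C *: (v - pi b w).
      by rewrite -bw addrAC subrr add0r scalerA dd scale1r.
    apply: unit_approximableZ => //; apply: unit_approximableD => //.
    by rewrite -scaleN1r; apply: unit_approximableZ;
      exact: unit_approximable_rep.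
  have [u [Ju u8 upos uw]] := positive_approx_unit Jid Jstar wP (d0 n).
  pose b' := b + (d n.+1)%:C%C *: u.
  have bpos' x : 0 <= inner (pi b' x) x.
    rewrite !repE linearDl linearZl_LR/= addr_ge0// mulr_ge0//.
    by rewrite (lecR 0) ltW.
  have [w' bw'] := positive_shift_surj v bpos' (d0 n.+1).
  exists (b', w'); first split=> //=.
    by apply: idealD => //; exact: idealZ.
  split=> /=.
    rewrite /b' addrAC subrr add0r rnormZr; last exact: ltW.
    have := ler_wpM2l (ltW (d0 n.+1)) u8; have := dS n; have := d0 n.+1; lra.
  rewrite mul1r; apply: le_trans uw; rewrite -(ler_pM2l (d0 n.+1)).
  apply: le_trans (positive_shift_lower (ltW (d0 n.+1)) (bpos' _)) _.
  have -> : pi b' (w' - w) + (d n.+1)%:C%C *: (w' - w) =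
      (d n.+1)%:C%C *: (w - pi u w).
    transitivity ((pi b' w' + (d n.+1)%:C%C *: w') -
        (pi b' w + (d n.+1)%:C%C *: w)); first by rewrite !opE; lin_id.
    by rewrite bw' -bw dS !repE (rmorphD (real_complex R)); lin_id.
  by rewrite rnormZr// ltW.
have [|||b fb] := @geometric_cvg R A (fun n => (f n).1) 8 2^-1.
- by rewrite invr_ge0.
- by lra.
- by move=> n; case: (fQ n).
have [|||w fw] := @geometric_cvg R H (fun n => (f n).2) 1 2^-1.
- by rewrite invr_ge0.
- by lra.
- by move=> n; case: (fQ n).
exists b, w; split.
  have [_ Jc _ _] := Jid; apply: (closed_cvg _ Jc _ _ fb).
  by apply: nearW => n; case: (fP n).
apply/eqP; rewrite -subr_eq0; apply/eqP; apply: rnorm_small => e e0.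
move/cvg_rnorm: fb => fb; move/cvg_rnorm: fw => fw.
pose W := rnorm w + 1; have W1 : 0 < W by rewrite ltr_wpDl ?rnorm_ge0.
pose B := 2 * rnorm b + 1;
  have B1 : 0 < B by rewrite ltr_wpDl ?mulr_ge0 ?rnorm_ge0.
have [|N1 NP1] := fb (e / (6 * W)); first by rewrite divr_gt0 ?mulr_gt0.
have [|N2 NP2] := fw (Num.min 1 (e / (3 * B))).
  by rewrite lt_min ltr01 divr_gt0 ?mulr_gt0.
have [|N3 NP3] := @half_pow_cvg0 (e / (3 * W));
  first by rewrite divr_gt0 ?mulr_gt0.
pose n := maxn N1 (maxn N2 N3).
have {NP1} := NP1 n (leq_maxl _ _).
have {NP2} := NP2 n (leq_trans (leq_maxl N2 N3) (leq_maxr _ _)).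
have {NP3} := NP3 n (leq_trans (leq_maxr N2 N3) (leq_maxr _ _)).
rewrite lt_min -/(d n) !ltr_pdivlMr ?mulr_gt0//.
have [_ _ <-] := fP n; case: (f n) => bn wn /= dn /andP[wn1 wnw] bnb.
have wnW : rnorm wn <= W.
  by have := rnormD (wn - w) w; rewrite subrK /W; lra.
have -> : pi bn wn + (d n)%:C%C *: wn - pi b w =
  pi (bn - b) wn + pi b (wn - w) + (d n)%:C%C *: wn by rewrite !repE !opE;
    lin_id.
have := rnormD (pi (bn - b) wn + pi b (wn - w)) ((d n)%:C%C *: wn).
have := rnormD (pi (bn - b) wn) (pi b (wn - w)).
rewrite rnormZr; last exact: ltW.
have := rep_bound pi (bn - b) wn; have := rep_bound pi b (wn - w).
have := ler_wpM2l (rnorm_ge0 (bn - b)) wnW.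
have := ler_wpM2l (ltW (d0 n)) wnW.
have := rnorm_ge0 (wn - w); have := rnorm_ge0 b.
move: wnw dn bnb; rewrite /B; clearbody W; lra.
Qed.

Lemma closed_span_factorization v :
  closure (lin_span [set y | exists a x, J a /\ y = pi a x]) v ->
  exists b w, J b /\ v = pi b w.
Proof. by move=> /(unit_approximable_closure Jid);
  exact: cohen_factorization. Qed.

End Cohen.

(** * Idempotents of inverse semigroups *)

Section InverseSemigroups.
Variable S : invSemigroupType.
Implicit Types s t e f : S.
Local Open Scope group_scope.

Lemma sinvK s : s^*^* = s.
Proof. by apply: esym; apply: sinv_unique;
  rewrite (sinv_mul_sinv, mul_sinv_mul). Qed.

Lemma sidem_sinv e : sidem e -> e^* = e.
Proof. by move=> ee; apply: esym; apply: sinv_unique; rewrite !ee. Qed.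

(** For [x = (e f)^*], the element [f x e] is again an inverse of [e f], hence
    equals [x] and is idempotent; so is its inverse [e f]. *)
Lemma sidem_mul e f : sidem e -> sidem f -> sidem (e * f).
Proof.
move=> ee ff; pose x := (e * f)^*.
have xefx : x * e * f * x = x by have := sinv_mul_sinv (e * f); rewrite mulgA.
have efxef : e * f * x * e * f = e * f.
  by have := mul_sinv_mul (e * f); rewrite !mulgA.
have fxefxe : f * x * e * f * x * e = f * x * e by rewrite -[in RHS]xefx !mulgA.
have fxe : f * x * e = x.
  apply: sinv_unique; rewrite !mulgA.
    by rewrite -(mulgA e f f) ff -(mulgA (e * f * x) e e) ee.
  by rewrite -(mulgA (f * x) e e) ee -(mulgA (f * x * e) f f) ff.
have xx : x * x = x.
  transitivity (f * x * e * (f * x * e)); first by rewrite fxe.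
  by rewrite !mulgA fxefxe.
by have := sidem_sinv xx; rewrite sinvK => ->.
Qed.

Lemma sidem_comm e f : sidem e -> sidem f -> e * f = f * e.
Proof.
move=> ee ff; have efef := sidem_mul ee ff; have fefe := sidem_mul ff ee.
rewrite -(sidem_sinv efef); apply: esym; apply: sinv_unique; rewrite !mulgA.
  rewrite -(mulgA e f f) ff -(mulgA (e * f) e e) ee.
  by rewrite -mulgA; exact: efef.
rewrite -(mulgA f e e) ee -(mulgA (f * e) f f) ff.
by rewrite -mulgA; exact: fefe.
Qed.

Lemma sidem_sinvl s : sidem (s^* * s).
Proof. by rewrite /sidem mulgA sinv_mul_sinv. Qed.

Lemma sidem_sinvr s : sidem (s * s^* ).
Proof. by rewrite /sidem mulgA mul_sinv_mul. Qed.

Lemma sinvM s t : (s * t)^* = t^* * s^*.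
Proof.
apply: esym; apply: sinv_unique.
  transitivity (s * (t * t^* * (s^* * s)) * t); first by rewrite !mulgA.
  rewrite (sidem_comm (sidem_sinvr t) (sidem_sinvl s)).
  transitivity (s * s^* * s * (t * t^* * t)); first by rewrite !mulgA.
  by rewrite !mul_sinv_mul.
transitivity (t^* * (s^* * s * (t * t^* )) * s^* ); first by rewrite !mulgA.
rewrite (sidem_comm (sidem_sinvl s) (sidem_sinvr t)).
transitivity (t^* * t * t^* * (s^* * s * s^* )); first by rewrite !mulgA.
by rewrite !sinv_mul_sinv.
Qed.

(** An idempotent passes across [t] at the price of being conjugated. This is
    why [[s s^* t, pi] = [t, pi]]. *)
Lemma mul_conj_sidem s t : sidem s -> t * (t^* * s * t) = s * t.
Proof.
move=> ss; rewrite !mulgA (sidem_comm (sidem_sinvr t) ss).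
by rewrite -!mulgA (mulgA t) mul_sinv_mul.
Qed.

Lemma sidem_conj s t : sidem s -> sidem (t^* * s * t).
Proof.
move=> ss; rewrite /sidem -(mulgA _ t) mul_conj_sidem//.
by rewrite mulgA -(mulgA _ s s) ss.
Qed.

End InverseSemigroups.

(** * Factorization in irreducible representations *)

Section LinearSpans.
Variables (R : realType) (V : normedModType R[i]).
Local Notation C := R[i].

Lemma lin_span_subspace (X : set V) : lin_subspace (lin_span X).
Proof.
split=> [|c _ _ [n [a [x [xX ->]]]] [m [b [y [yX ->]]]]].
  by exists 0%N, (fun=> 0), (fun=> 0); split=> [[]//|]; rewrite big_ord0.
pose pick T (f : 'I_n -> T) (g : 'I_m -> T) i :=
  match fintype.split i with inl j => f j | inr j => g j end.
exists (n + m)%N, (pick C (fun i => c * a i) b), (pick V x y); split=> [i|].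
  by rewrite /pick; case: fintype.splitP.
rewrite big_split_ord scaler_sumr; congr (_ + _); apply: eq_bigr => i _.
  by rewrite /pick (unsplitK (inl i)) scalerA.
by rewrite /pick (unsplitK (inr i)).
Qed.

Lemma closure_subspace (W : set V) : lin_subspace W -> lin_subspace (closure W).
Proof.
move=> [W0 WD]; split=> [|c x y Wx Wy]; first exact: subset_closure.
apply/closure_rnorm => e e0; pose r := complex.Re `|c| + 1.
have c0 : 0 <= complex.Re `|c|.
  by rewrite -lecR RRe_real ?normr_real//; exact: normr_ge0.
have r0 : 0 < r by rewrite ltr_wpDl.
have [|x' Wx' xx'] := (closure_rnorm _ _).1 Wx (e / (2 * r)).
  by rewrite divr_gt0// mulr_gt0.
have [|y' Wy' yy'] := (closure_rnorm _ _).1 Wy (e / 2);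
  first by rewrite divr_gt0.
exists (c *: x' + y'); first exact: WD.
have -> : c *: x + y - (c *: x' + y') = c *: (x - x') + (y - y') by lin_id.
have := rnormD (c *: (x - x')) (y - y'); rewrite rnormZ.
move: xx'; rewrite ltr_pdivlMr ?mulr_gt0// /r.
have := rnorm_ge0 (x - x'); nra.
Qed.

Lemma lin_span_sub (X : set V) : X `<=` lin_span X.
Proof.
move=> x Xx; exists 1%N, (fun=> 1), (fun=> x); split=> //.
by rewrite big_ord1 scale1r.
Qed.

End LinearSpans.

Section BoundedOperators.
Variables (R : realType) (H : hilbertType R).
Local Notation C := R[i].

Section Construction.
Variables (f : H -> H) (M : R).
Hypotheses (f_lin : linear f) (f_bound : forall x, rnorm (f x) <= M * rnorm x).

Let f_linear : {linear H -> H} :=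
  HB.pack_for {linear H -> H} f (GRing.isLinear.Build C H H _ f f_lin).

Fact mk_bop_bounded : exists M : C, forall x : H, `|f_linear x| <= M * `|x|.
Proof. by exists M%:C%C => x;
  rewrite !rnormE -(rmorphM (real_complex R)) lecR. Qed.

Definition mk_bop : bop H := BOp mk_bop_bounded.

Lemma mk_bopE x : mk_bop x = f x. Proof. by []. Qed.

End Construction.

Lemma bop_lipschitz (T : bop H) : exists M : R, forall x,
  rnorm (T x) <= M * rnorm x.
Proof.
have [M TM] := bop_bounded T; exists (complex.Re M) => x.
have := le_rnorm (TM x); rewrite rnormE.
by case: M TM => a b _ /=; rewrite mulr0 subr0.
Qed.

Lemma inner_ext (x y : H) : (forall z, inner x z = inner y z) -> x = y.
Proof.
move=> xy; apply/eqP; rewrite -subr_eq0; apply/eqP; apply: rnorm_eq0; apply/eqP.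
rewrite -sqrf_eq0 -(inj_eq (@complexI R)) -inner_rnorm.
by rewrite (linearBl inner)/= xy subrr.
Qed.

End BoundedOperators.

Section IrreducibleFactorization.
Variables (R : realType) (A : cstarType R) (H : hilbertType R).
Variables (pi : representation A H) (J : set A).
Hypotheses (Jid : ideal J) (Jstar : forall a, J a -> J (astar a)).

(** The closed span of [pi(J) H] is invariant and nonzero, hence everything,
    and Cohen factorization turns approximation into equality. *)
Lemma irreducible_factorization v : irreducible_rep pi -> in_hat J pi ->
  exists b w, J b /\ v = pi b w.
Proof.
move=> [_ pi_irr] [b [x [Jb bx]]]; apply: (closed_span_factorization Jid Jstar).
set X := [set y | _].
have [|||X0|->//] := pi_irr (closure (lin_span X)).
- by apply: closure_subspace; exact: lin_span_subspace.
- exact: closed_closure.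
- move=> a y Xy; apply/closure_rnorm => e e0.
  pose r := 2 * rnorm a + 1.
  have r0 : 0 < r by rewrite ltr_wpDl// mulr_ge0 ?rnorm_ge0.
  have [|z [n [c [u [uX ->]]]] yz] := (closure_rnorm _ _).1 Xy (e / r).
    by rewrite divr_gt0.
  exists (pi a (\sum_(i < n) c i *: u i)).
    rewrite linear_sum/=; exists n, c, (fun i => pi a (u i)); split.
      move=> i; have [d [w [Jd ->]]] := uX i; exists (a ** d), w.
      by rewrite rep_amul; split=> //; case: Jid => _ _ Jl _; exact: Jl.
    by apply: eq_bigr => i _; rewrite linearZ.
  rewrite -bopN -bopD; apply: le_lt_trans (rep_bound _ _ _) _.
  move: yz; rewrite ltr_pdivlMr// /r; set z' := \sum_(i < n) _.
  have := rnorm_ge0 (y - z'); lra.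
- have : [set (0 : H)] (pi b x).
    by rewrite -X0; apply/subset_closure/lin_span_sub; exists b, x.
  by move=> /= pbx0; rewrite pbx0 eqxx in bx.
Qed.

End IrreducibleFactorization.

(** * Actions and induced representations *)

Section Actions.
Variables (S : invSemigroupType) (R : realType) (A : cstarType R).
Variable alpha : action S A.
Implicit Types (s t e f : S) (a b c : A).

Lemma pdomP s a : pdom (alpha s) a <-> exists b, alpha s a = Some b.
Proof.
rewrite /pdom/=; case: (alpha s a) => [b|]; last by split=> // -[].
by split=> // _; exists b.
Qed.

Lemma pdomI s a b : alpha s a = Some b -> pdom (alpha s) a.
Proof. by move=> sa; apply/pdomP; exists b. Qed.

Lemma act_mulE s t a b : alpha t a = Some b -> alpha (s * t)%g a = alpha s b.
Proof. by move=> ta; rewrite act_mul /pcomp/= ta. Qed.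

Lemma act_mulP s t a c : alpha (s * t)%g a = Some c ->
  exists2 b, alpha t a = Some b & alpha s b = Some c.
Proof.
by rewrite act_mul /pcomp/=; case: (alpha t a) => //= b sb; exists b.
Qed.

Lemma act_sinv s a b : alpha s a = Some b -> alpha s^*%g b = Some a.
Proof.
move=> sab; have := sab; rewrite -{1}(mul_sinv_mul s) => /act_mulP[b'].
rewrite sab => -[<-{b'}] /act_mulP[c sc] sc'.
by rewrite sc; congr Some; exact: pbij_inj sc' sab.
Qed.

Lemma act_sinvE s a b : alpha s^*%g b = Some a <-> alpha s a = Some b.
Proof. by split=> /act_sinv//; rewrite sinvK. Qed.

Lemma act_sidem e a b : sidem e -> alpha e a = Some b -> b = a.
Proof.
move=> ee ab; have := ab; rewrite -{1}ee => /act_mulP[c].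
by rewrite ab => -[<-] bb; exact: pbij_inj bb ab.
Qed.

Lemma pdom_sidemE e a : sidem e -> pdom (alpha e) a -> alpha e a = Some a.
Proof. by move=> ee /pdomP[b ab]; rewrite ab (act_sidem ee ab). Qed.

Lemma pdom_mulr s t a : pdom (alpha (s * t)%g) a -> pdom (alpha t) a.
Proof. by move=> /pdomP[c /act_mulP[b ab _]]; exact: pdomI ab. Qed.

Lemma pdom_source s : pdom (alpha (s^* * s)%g) = pdom (alpha s).
Proof.
apply/seteqP; split=> a; first exact: pdom_mulr.
by move=> /pdomP[b ab]; apply: (@pdomI _ _ a);
  rewrite (act_mulE _ ab) (act_sinv ab).
Qed.

Lemma pdom_range s : pdom (alpha (s * s^* )%g) = pdom (alpha s^*%g).
Proof. by rewrite -{1}(sinvK s) pdom_source. Qed.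

Lemma pdom_astar s a : pdom (alpha s) a -> pdom (alpha s) (astar a).
Proof. by move=> /pdomP[b ab]; exact: pdomI (act_astar ab). Qed.

Lemma pdom_mull s a b : pdom (alpha s) b -> pdom (alpha s) (a ** b).
Proof. by case: (act_ideal alpha s) => _ _ Jl _; exact: Jl. Qed.

Lemma pdom_mulA s a b : pdom (alpha s) a -> pdom (alpha s) (a ** b).
Proof. by case: (act_ideal alpha s) => _ _ _; exact. Qed.

(** The range of [alpha_t] is the domain of [alpha_(t^* )], hence absorbs
    [a]. *)
Lemma act_pull t a b b' : alpha t b = Some b' ->
  exists c, alpha t c = Some (a ** b').
Proof.
move=> tb; have /(pdom_mull a)/pdomP[c /act_sinvE tc] := pdomI (act_sinv tb).
by exists c.
Qed.

Section Irreducible.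
Variables (H : hilbertType R) (pi : representation A H).
Hypothesis pi_irr : irreducible_rep pi.

Lemma factor_over s v : in_hat (pdom (alpha s)) pi ->
  exists b w, pdom (alpha s) b /\ v = pi b w.
Proof.
apply: irreducible_factorization => //; first exact: act_ideal.
exact: pdom_astar.
Qed.

Lemma over_domE s : over_dom alpha pi s = in_hat (pdom (alpha s)) pi.
Proof. by rewrite /over_dom pdom_source. Qed.

(** If [pi(a) x] is nonzero with [a] in the first ideal, write [x = pi(b) y]
    with [b] in the second one; then [a b] lies in both. *)
Lemma in_hat_mul_sidem s e : sidem e -> in_hat (pdom (alpha s)) pi ->
  in_hat (pdom (alpha e)) pi -> in_hat (pdom (alpha (s * e)%g)) pi.
Proof.
move=> ee [a [x [sa ax]]] /(factor_over x)[b [y [eb xE]]].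
exists (a ** b), y; split; last by rewrite rep_amul -xE.
have /pdomP[c sc] := pdom_mulA b sa.
by apply: (@pdomI _ _ c);
  rewrite (act_mulE _ (pdom_sidemE ee (pdom_mull a eb))).
Qed.

Section InducedExistence.
Variable t : S.
Hypothesis t_over : in_hat (pdom (alpha t)) pi.

(** The graph of the operator [beta_t(pi)(a)]: it sends [pi(b) w] to
    [pi(alpha_(t^* )(a alpha_t(b))) w]. By factorization every vector has the
    form [pi(b) w], so no extension by continuity is involved. *)
Definition induced_graph a v y : Prop := exists b b' c w,
  [/\ alpha t b = Some b', alpha t c = Some (a ** b'), v = pi b w & y = pi c w].

Lemma induced_graph_total a v : exists y, induced_graph a v y.
Proof.
have [b [w [/pdomP[b' bb'] ->]]] := factor_over v t_over.
by have [c cc'] := act_pull a bb'; exists (pi c w), b, b', c, w.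
Qed.

(** This adjunction formula determines the value of the operator at [v] from
    inner products alone; well-definedness and linearity follow. *)
Lemma induced_graph_inner a v y v2 y2 : induced_graph a v y ->
  induced_graph (astar a) v2 y2 -> inner y v2 = inner v y2.
Proof.
move=> [b [b' [c [w [tb tc -> ->]]]]] [b2 [b2' [c2 [w2 [tb2 tc2 -> ->]]]]].
rewrite !rep_inner -!rep_amul; congr (inner _ (pi _ _)).
have := act_amul (act_astar tb) tc2; have := act_amul (act_astar tc) tb2.
by rewrite astarM amulA => tcb tbc; rewrite (pbij_inj tcb tbc).
Qed.

Lemma induced_graph_unique a v y y' : induced_graph a v y ->
  induced_graph a v y' -> y = y'.
Proof.
move=> ay ay'; apply: inner_ext => z;
  have [z' az] := induced_graph_total (astar a) z.
by rewrite (induced_graph_inner ay az) (induced_graph_inner ay' az).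
Qed.

Let E a v : H := sval (cid (induced_graph_total a v)).

Let EP a v : induced_graph a v (E a v).
Proof. exact: svalP. Qed.

Let E_inner a v v2 : inner (E a v) v2 = inner v (E (astar a) v2).
Proof. exact: induced_graph_inner. Qed.

Let E_linear a : linear (E a).
Proof.
move=> k x y; apply: inner_ext => z.
by rewrite !(linearPl inner) /= !E_inner linearPl.
Qed.

Let E_lin_alg (k : R[i]) a b v : E (k *: a + b) v = k *: E a v + E b v.
Proof.
have [d [w [/pdomP[d' dd'] vE]]] := factor_over v t_over.
have [ca tca] := act_pull a dd'; have [cb tcb] := act_pull b dd'.
have Ea : E a v = pi ca w.
  by apply: (induced_graph_unique (EP a v)); exists d, d', ca, w.
have Eb : E b v = pi cb w.
  by apply: (induced_graph_unique (EP b v)); exists d, d', cb, w.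
rewrite Ea Eb -rep_linear; apply: (induced_graph_unique (EP _ v)).
exists d, d', (k *: ca + cb), w; split=> //.
by rewrite amulDl amulZl; exact: act_linear.
Qed.

Let E_amul a b v : E (a ** b) v = E a (E b v).
Proof.
have [d [w [/pdomP[d' dd'] vE]]] := factor_over v t_over.
have [cb tcb] := act_pull b dd'; have [ca tca] := act_pull a tcb.
have Eb : E b v = pi cb w.
  by apply: (induced_graph_unique (EP b v)); exists d, d', cb, w.
rewrite Eb; transitivity (pi ca w).
  apply: (induced_graph_unique (EP _ v)); exists d, d', ca, w; split=> //.
  by rewrite -amulA.
by apply: (induced_graph_unique _ (EP _ _)); exists cb, (b ** d'), ca, w.
Qed.

Let E_bound a v : rnorm (E a v) <= 2 * rnorm a * rnorm v.
Proof.
have ED b c : E (b + c) v = E b v + E c v.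
  by have := E_lin_alg 1 b c v; rewrite !scale1r.
have E0 : E 0 v = 0 by apply: (addrI (E 0 v)); rewrite -ED !addr0.
apply: (gram_bound (F := E^~ v)) => // [k b|b c].
  by have := E_lin_alg k b 0 v; rewrite !addr0 E0 addr0.
by rewrite E_inner E_amul.
Qed.

Definition induced_extension : representation A H.
Proof.
apply: (@Representation R A H (fun a => mk_bop (E_linear a) (E_bound a))).
- by move=> k a b x; exact: E_lin_alg.
- by move=> a b x; exact: E_amul.
- by move=> a x y; rewrite !mk_bopE E_inner astarK.
Defined.

Lemma induced_extensionE a b : alpha t^*%g a = Some b ->
  forall x, induced_extension a x = pi b x.
Proof.
move=> /act_sinvE tb x;
  have [d [w [/pdomP[d' dd'] ->]]] := factor_over x t_over.
rewrite -rep_amul; apply: (induced_graph_unique (EP a _)).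
by exists d, d', (b ** d), w; split=> //; exact: act_amul.
Qed.

End InducedExistence.

Lemma induced_rep_ext t a b x : over_dom alpha pi t -> alpha t b = Some a ->
  induced_rep alpha t pi a x = pi b x.
Proof.
rewrite over_domE => ht /act_sinvE tab; rewrite /induced_rep.
by case: xgetP => [eta _ etaP|/(_ (induced_extension ht))[]];
  [exact: etaP|exact: induced_extensionE].
Qed.

(** The operator of [a] on a vector [pi(b) w] is read off inside the domain of
    [alpha_t], without a formula for the extension. *)
Lemma induced_repE t a b b' c w : over_dom alpha pi t ->
  alpha t b = Some b' -> alpha t c = Some (a ** b') ->
  induced_rep alpha t pi a (pi b w) = pi c w.
Proof.
move=> ht tb tc.
by rewrite -(induced_rep_ext w ht tb) -rep_amul (induced_rep_ext w ht tc).
Qed.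

(** For [s] replaced by [s^*], this identifies the case distinction defining
    [sigma_pi(s)] at [[t, pi]] with the condition that [[s^* t, pi]] be a
    germ. *)
Lemma in_hat_induced s t : over_dom alpha pi t ->
  in_hat (pdom (alpha s)) (induced_rep alpha t pi) <->
  over_dom alpha pi (s * t)%g.
Proof.
move=> ht; rewrite over_domE;
  split=> [[a [x [sa ax]]]|[c [w [/pdomP[d stc] cw]]]].
  have := ht; rewrite over_domE => /(factor_over x)[b [w [/pdomP[b' tb] xE]]].
  have [c tc] := act_pull a tb; exists c, w; split.
    have /pdomP[d sd] := pdom_mulA b' sa.
    by apply: (@pdomI _ _ d); rewrite (act_mulE _ tc).
  by rewrite -(induced_repE w ht tb tc) -xE.
have [c' tc sc'] := act_mulP stc; exists c', w; split; first exact: pdomI sc'.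
by rewrite (induced_rep_ext _ ht tc).
Qed.

(** [beta_t(pi)] depends on the germ of [t] only: vectors factor through the
    domain of [alpha_(t e)], where [alpha_t] and [alpha_t'] coincide. *)
Lemma induced_rep_restrict t t' e a v : sidem e -> in_hat (pdom (alpha e)) pi ->
  over_dom alpha pi t -> over_dom alpha pi t' -> (t * e = t' * e)%g ->
  induced_rep alpha t pi a v = induced_rep alpha t' pi a v.
Proof.
move=> ee he ht ht' tt'.
have hte : in_hat (pdom (alpha (t * e)%g)) pi.
  by apply: in_hat_mul_sidem => //; rewrite -over_domE.
have [b [w [/pdomP[b' teb] ->]]] := factor_over v hte.
have [c tec] := act_pull a teb.
have eP x y : alpha (t * e)%g x = Some y ->
  alpha t x = Some y /\ alpha t' x = Some y.
  move=> tex; have := tex; rewrite tt' => /act_mulP[x1 ex /[dup]].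
  have := tex => /act_mulP[x2]; rewrite ex => -[<-].
  by rewrite (act_sidem ee ex).
have [tb t'b] := eP _ _ teb; have [tc t'c] := eP _ _ tec.
by rewrite (induced_repE w ht tb tc) (induced_repE w ht' t'b t'c).
Qed.

(** Pointwise form of the covariance relation: [beta_t(pi) (alpha_s(a)) =
    beta_(s^* t)(pi) (a)]. *)
Lemma induced_rep_mul s t a b v : over_dom alpha pi t ->
  over_dom alpha pi (s^* * t)%g -> alpha s a = Some b ->
  induced_rep alpha t pi b v = induced_rep alpha (s^* * t)%g pi a v.
Proof.
move=> ht hst sa; have := hst; rewrite over_domE => /(factor_over v).
move=> [d [w [/pdomP[d1 std] ->]]]; have [d2 td sd2] := act_mulP std.
have /act_sinvE sd1 := sd2.
have [c stc] := act_pull a std; have [c2 tc sc2] := act_mulP stc.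
rewrite (induced_repE w hst std stc); apply: (induced_repE w ht td).
rewrite tc; congr Some; apply: pbij_inj sc2 _.
by apply/act_sinvE; exact: act_amul.
Qed.

End Irreducible.
End Actions.

(** * Operators on square-summable families *)

Section InnerBound.
Variables (R : realType) (H : hilbertType R).
Local Notation C := R[i].

(** A Cauchy-Schwarz inequality with the constant [2], read off from the
    polarization identity; only continuity of the inner product is at stake. *)
Lemma inner_bound (x y : H) : `|inner x y| <= (2 * rnorm x * rnorm y)%:C%C.
Proof.
have half w : rnorm w = rnorm y ->
    `| `|x + w| ^+ 2 - `|x - w| ^+ 2| <= (4 * (rnorm x * rnorm y))%:C%C.
  move=> wy; rewrite !rnormE -!(rmorphXn (real_complex R)) -(rmorphB
    (real_complex R)).
  rewrite real_ler_norml ?complex_real// -(rmorphN (real_complex R)) !lecR.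
  have := rnormD x w; have := rnormB x w.
  have := rnormB (x + w) w; rewrite addrK.
  have := rnormB (x + w) x; rewrite addrAC subrr add0r.
  have := rnormD (x - w) w; rewrite subrK.
  have := rnormB (x - w) x; rewrite addrAC subrr add0r rnormN wy.
  have := rnorm_ge0 x; have := rnorm_ge0 y.
  have := rnorm_ge0 (x + w); have := rnorm_ge0 (x - w).
  set n := rnorm x; set m := rnorm y; set a := rnorm (x + w);
    set b := rnorm (x - w).
  clearbody n m a b => b0 a0 m0 n0 h1 h2 h3 h4 h5 h6.
  have aU : a ^+ 2 <= (n + m) ^+ 2 by rewrite ler_pXn2r ?nnegrE ?addr_ge0.
  have bU : b ^+ 2 <= (n + m) ^+ 2 by rewrite ler_pXn2r ?nnegrE ?addr_ge0.
  have aL : (n - m) ^+ 2 <= a ^+ 2.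
    by rewrite -[leLHS]real_normK ?num_real// ler_pXn2r ?nnegrE// ler_norml;
      lra.
  have bL : (n - m) ^+ 2 <= b ^+ 2.
    by rewrite -[leLHS]real_normK ?num_real// ler_pXn2r ?nnegrE// ler_norml;
      lra.
  by apply/andP; split; nra.
rewrite polarization normrM;
  apply: le_trans (ler_wpM2l (normr_ge0 _) (ler_normD _ _)) _.
rewrite normrM normCi mul1r.
apply: le_trans (ler_wpM2l (normr_ge0 _) (lerD (half _ erefl) (half _ (rnormZi
  y)))) _.
rewrite normfV normr_nat -(rmorphD (real_complex R)) -(rmorph_nat (real_complex
  R)) -(fmorphV (real_complex R)).
by rewrite -(rmorphM (real_complex R)) lecR; lra.
Qed.

End InnerBound.

Section Ell2.
Variables (R : realType) (I : choiceType) (H : hilbertType R).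
Local Notation C := R[i].
Local Notation L := (ell2 I H).
Implicit Types (xi eta : L) (v : H) (J : {fset I}).

Lemma ell2_sum_le xi J : \sum_(i <- J) `|xi i| ^+ 2 <= (rnorm xi ^+ 2)%:C%C.
Proof. by rewrite -inner_rnorm; exact: (ell2_dot_bound xi).1. Qed.

Lemma ell2_rnorm_le xi (M : R) : 0 <= M ->
  (forall J, \sum_(i <- J) `|xi i| ^+ 2 <= (M ^+ 2)%:C%C) -> rnorm xi <= M.
Proof.
move=> M0 /(ell2_dot_bound xi).2;
  rewrite -[ell2_dot _ _]/(inner xi xi) inner_rnorm lecR.
by rewrite ler_pXn2r ?nnegrE ?rnorm_ge0.
Qed.

Section Operators.
Variables (g : L -> I -> H) (M : R).
Hypotheses (M0 : 0 <= M)
  (g_lin : forall k xi eta i, g (k *: xi + eta) i = k *: g xi i + g eta i)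
  (g_bound : forall xi J,
    \sum_(i <- J) `|g xi i| ^+ 2 <= ((M * rnorm xi) ^+ 2)%:C%C).

Let g_summable xi : g xi \in @sq_summable R I H.
Proof. by apply/sq_summableP; exists ((M * rnorm xi) ^+ 2)%:C%C;
  exact: g_bound. Qed.

Let G xi : L := Ell2 (g_summable xi).

Let G_linear : linear G.
Proof. by move=> k x y; apply: ell2_eqP => i; exact: g_lin. Qed.

Let G_bound xi : rnorm (G xi) <= M * rnorm xi.
Proof. by apply: ell2_rnorm_le; rewrite ?mulr_ge0 ?rnorm_ge0//;
  exact: g_bound. Qed.

Definition ell2_op : bop L := mk_bop G_linear G_bound.

End Operators.

#[local] Existing Instance totally_filter.

Fact delta_summable i v :
  (fun j => if j == i then v else 0) \in @sq_summable R I H.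
Proof.
apply/sq_summableP; exists (`|v| ^+ 2) => J.
have [iJ|iJ] := boolP (i \in J).
  rewrite (big_fsetD1 i)//= eqxx big1_seq ?addr0// => j /andP[_].
  by rewrite !inE => /andP[/negPf-> _]; rewrite normr0 expr0n.
rewrite big1_seq ?exprn_ge0// => j /andP[_ jJ].
have [ji|_] := eqVneq j i; first by rewrite ji (negPf iJ) in jJ.
by rewrite normr0 expr0n.
Qed.

Definition ell2_delta i v : L := Ell2 (delta_summable i v).

Lemma inner_delta xi i v : inner xi (ell2_delta i v) = inner (xi i) v.
Proof.
have := @ell2_dot_cvg R I H xi (ell2_delta i v).
set u := partial_sum _ => ul.
have uE : \forall J \near totally, u J = inner (xi i) v.
  exists [fset i]%fset => // J /=; rewrite fsub1set => iJ.
  rewrite /u partial_sumE (big_fsetD1 i)//= eqxx big1_seq ?addr0// => j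
    /andP[_].
  by rewrite !inE => /andP[/negPf-> _]; rewrite linear0r.
have ul' : u J @[J --> totally] --> (inner (xi i) v :
  C^o) by exact: cvg_near_cst uE.
exact: (@cvg_unique C^o _ _ _ _ _ ul ul').
Qed.

(** The squared distance from [xi] to its restriction to [J] is [|xi|^2] minus
    the sum of [|xi i|^2] over [J]. *)
Lemma ell2_finite_approx xi (e : R) : 0 < e -> exists J,
  rnorm (xi - \sum_(i <- J) ell2_delta i (xi i)) < e.
Proof.
move=> e0; have [J JP] : exists J,
    ~ (\sum_(i <- J) `|xi i| ^+ 2 <= inner xi xi - (e ^+ 2)%:C%C).
  apply/existsNP => /(ell2_dot_bound xi).2;
    rewrite -[ell2_dot _ _]/(inner xi xi).
  by rewrite lerBrDl gerDr (lecR _ 0) leNgt exprn_gt0.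
exists J; set xiJ := \sum_(i <- J) _.
have xiJE j : j \in J -> xiJ j = xi j.
  move=> jJ; rewrite /xiJ.
  rewrite (@big_morph _ _ (fun f : L => f j) 0 +%R)//.
  rewrite (big_fsetD1 j)//= eqxx big1_seq ?addr0// => i /andP[_].
  by rewrite !inE => /andP[]; rewrite eq_sym => /negPf->.
have dE eta : (forall j, j \in J -> eta j = xi j) ->
    inner eta xiJ = \sum_(i <- J) `|xi i| ^+ 2.
  move=> etaJ; rewrite /xiJ linear_sumr/=; apply: eq_big_seq => i iJ.
  by rewrite inner_delta etaJ// inner_norm.
have sumR : (\sum_(i <- J) `|xi i| ^+ 2)^* = \sum_(i <- J) `|xi i| ^+ 2 :> C.
  by apply/CrealP; rewrite rpred_sum// => i _; rewrite rpredX// normr_real.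
have : inner (xi - xiJ) (xi - xiJ) = inner xi xi - \sum_(i <- J) `|xi i| ^+ 2.
  by rewrite dnormB !dE//= sumR; ring.
rewrite inner_rnorm => E.
have sE : \sum_(i <- J) `|xi i| ^+ 2 = (\sum_(i <- J) rnorm (xi i) ^+ 2)%:C%C.
  rewrite rmorph_sum/=; apply: eq_bigr => i _;
    by rewrite rnormE (rmorphXn (real_complex R)).
move: JP E; rewrite sE inner_rnorm -!(rmorphB (real_complex R)) lecR => JP
  /complexI E.
rewrite -(@ltr_pXn2r _ 2) ?nnegrE ?rnorm_ge0 ?(ltW e0)// E.
by rewrite ltrBlDr addrC -ltrBlDr ltNge; apply/negP.
Qed.

Lemma ell2_closure_span (X : set L) xi : (forall i, X (ell2_delta i (xi i))) ->
  closure (lin_span X) xi.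
Proof.
move=> Xxi; apply/closure_rnorm => e e0;
  have [J Je] := ell2_finite_approx xi e0.
exists (\sum_(i <- J) ell2_delta i (xi i)) => //.
have [X0 XD] := lin_span_subspace X.
elim/big_ind: _ => // [x y Xx Xy|i _]; first by rewrite -[x]scale1r; apply: XD.
exact: lin_span_sub.
Qed.

(** Vectors concentrated at one index span a dense subspace, and inner
    products are continuous. *)
Lemma adjoint_delta (f g : bop L) :
  (forall xi i v, inner (f xi) (ell2_delta i v) =
    inner xi (g (ell2_delta i v))) ->
  adjoint f g.
Proof.
move=> fg xi eta; have [M gM] := bop_lipschitz g.
pose K := 2 * (rnorm (f xi) + rnorm xi * `|M|) + 1.
have K0 : 0 < K.
  by rewrite ltr_wpDl// mulr_ge0// addr_ge0 ?rnorm_ge0// mulr_ge0 ?rnorm_ge0.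
apply/eqP; rewrite -subr_eq0 -normr_eq0; apply/eqP/le_anti.
rewrite normr_ge0 andbT -[0]/(0%:C%C).
rewrite -[leLHS]RRe_real ?normr_real// lecR.
apply/ler_addgt0Pr => e e0; rewrite add0r -lecR RRe_real ?normr_real//.
have eK : 0 < e / K by rewrite divr_gt0.
have [J] := ell2_finite_approx eta eK; set z := \sum_(i <- J) _ => Je.
have -> : inner (f xi) eta - inner xi (g eta) =
    inner (f xi) (eta - z) - inner xi (g (eta - z)).
  have zE : inner (f xi) z = inner xi (g z).
    have -> : g z = \sum_(i <- J) g (ell2_delta i (eta i)) by exact: linear_sum.
    by rewrite /z !linear_sumr/=; apply: eq_bigr => i _; exact: fg.
  by rewrite bopD bopN !(linearDr inner) !(linearNr inner)/= zE opprD opprK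
    addrACA addNr addr0.
apply: le_trans (ler_normB _ _) _.
apply: le_trans (lerD (inner_bound _ _) (inner_bound _ _)) _.
rewrite -(rmorphD (real_complex R)) lecR.
move: Je; rewrite ltr_pdivlMr// /K; move: (eta - z) => d.
have := gM d; have := rnorm_ge0 d; have := rnorm_ge0 xi; have := ler_norm M.
have := rnorm_ge0 (f xi).
move=> f0 MM x0 d0 gd dK.
have h1 : rnorm xi * rnorm (g d) <= rnorm xi * (`|M| * rnorm d).
  by rewrite ler_wpM2l// (le_trans gd)// ler_wpM2r.
nra.
Qed.

Section Diagonal.
Variables (T : I -> bop H) (M : R).
Hypotheses (M0 : 0 <= M) (T_bound : forall i x, rnorm (T i x) <= M * rnorm x).

Let diag_lin k xi eta i :
  T i ((k *: xi + eta) i) = k *: T i (xi i) + T i (eta i).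
Proof. by rewrite -bopZ -bopD. Qed.

Let diag_bound xi J :
  \sum_(i <- J) `|T i (xi i)| ^+ 2 <= ((M * rnorm xi) ^+ 2)%:C%C.
Proof.
apply: (@le_trans _ _ (\sum_(i <- J) (M ^+ 2)%:C%C * `|xi i| ^+ 2)).
  apply: ler_sum => i _; rewrite !rnormE -!(rmorphXn (real_complex R)).
  by rewrite -(rmorphM (real_complex R)) lecR -exprMn ler_pXn2r ?nnegrE
    ?mulr_ge0 ?rnorm_ge0.
have -> : ((M * rnorm xi) ^+ 2)%:C%C =
  (M ^+ 2)%:C%C * (rnorm xi ^+ 2)%:C%C :> C.
  by rewrite exprMn; exact: rmorphM.
rewrite -mulr_sumr ler_wpM2l ?ell2_sum_le//.
by rewrite (lecR 0) sqr_ge0.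
Qed.

Definition diag_op : bop L := ell2_op M0 diag_lin diag_bound.

Lemma diag_opE xi i : diag_op xi i = T i (xi i). Proof. by []. Qed.

Lemma diag_op_delta i v : diag_op (ell2_delta i v) = ell2_delta i (T i v).
Proof.
apply: ell2_eqP => j; rewrite diag_opE /=.
by have [->|_] := eqVneq j i; rewrite ?bop0.
Qed.

End Diagonal.

Section PartialInjection.
Variable phi : I -> option I.
Hypothesis phi_inj : forall i j k, phi i = Some k -> phi j = Some k -> i = j.

Let pull xi i : H := oapp xi 0 (phi i).

Let pull_lin k xi eta i : pull (k *: xi + eta) i = k *: pull xi i + pull eta i.
Proof. by rewrite /pull; case: (phi i) => //=; rewrite scaler0 addr0. Qed.

Let pull_bound xi J :
  \sum_(i <- J) `|pull xi i| ^+ 2 <= ((1 * rnorm xi) ^+ 2)%:C%C.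
Proof.
rewrite mul1r; have -> : \sum_(i <- J) `|pull xi i| ^+ 2 =
    \sum_(k <- pmap phi J) `|xi k| ^+ 2.
  elim: (J : seq I) => [|i s IH]; first by rewrite !big_nil.
  rewrite big_cons/= IH /pull; case: (phi i) => [k|]/=;
    first by rewrite big_cons.
  by rewrite normr0 expr0n add0r.
have u : uniq (pmap phi J).
  have := fset_uniq J; elim: (J : seq I) => //= i s IH /andP[si su].
  case E: (phi i) => [k|]/=; rewrite IH// andbT mem_pmap.
  by apply: contra si => /mapP[j js jE]; rewrite (phi_inj E (esym jE)).
apply: le_trans (ell2_sum_le xi [fset k in pmap phi J]%fset).
rewrite le_eqVlt; apply/orP; left; apply/eqP; apply: perm_big.
by apply: uniq_perm => // k; rewrite in_fset.
Qed.

(** The partial isometry [xi |-> xi \o phi], extended by zero where [phi] is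
    undefined. *)
Definition pull_op : bop L := ell2_op ler01 pull_lin pull_bound.

Lemma pull_opE xi i : pull_op xi i = oapp xi 0 (phi i). Proof. by []. Qed.

End PartialInjection.

Lemma pull_op_adjoint (phi psi : I -> option I) phi_inj psi_inj :
  (forall i j, phi i = Some j <-> psi j = Some i) ->
  adjoint (@pull_op phi phi_inj) (@pull_op psi psi_inj).
Proof.
move=> phipsi; apply: adjoint_delta => xi i v; rewrite inner_delta pull_opE.
case E: (phi i) => [k|].
  rewrite -[oapp _ _ _]/(xi k) -inner_delta; congr (inner _ _).
  apply: ell2_eqP => j; rewrite pull_opE /=.
  have [->|jk] := eqVneq j k; first by rewrite ((phipsi _ _).1 E) /= eqxx.
  case F: (psi j) => [l|] //=; case: eqVneq => // li; move: jk.
  by move: F; rewrite li => /phipsi; rewrite E => -[->]; rewrite eqxx.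
rewrite -[oapp _ _ _]/(0 : H) linear0l (_ : pull_op _ _ = 0) ?linear0r//.
apply: ell2_eqP => j; rewrite pull_opE; case F: (psi j) => [l|] //=.
by case: eqVneq => // li; move: F; rewrite li => /phipsi; rewrite E.
Qed.

End Ell2.

(** * The covariant representation on germs *)

Section Germs.
Variables (S : invSemigroupType) (R : realType) (A : cstarType R).
Variables (alpha : action S A) (H : hilbertType R) (pi : representation A H).
Hypothesis pi_irr : irreducible_rep pi.
Local Notation G := (germ alpha pi).
Implicit Types (s t r e : S) (g h : G).

Lemma germ_ext g h : germ_set g = germ_set h -> g = h.
Proof.
by case: g h => [X Xp] [Y Yp] /= XY; move: Xp Yp; rewrite XY => Xp Yp;
  congr MkGerm; exact: Prop_irrelevance.
Qed.

Lemma unitarily_equivalent_refl : unitarily_equivalent pi pi.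
Proof. by exists idfun; split=> // y; exists y. Qed.

Lemma germ_of_eq t t' (ht : over_dom alpha pi t) (ht' : over_dom alpha pi t') :
  germ_of ht = germ_of ht' <->
  exists e, [/\ sidem e, in_hat (pdom (alpha e)) pi & (t * e = t' * e)%g].
Proof.
split=> [/(congr1 (@germ_set _ _ _ _ _ _))/= E|[e [ee he tt']]].
  have : germ_class alpha pi t t.
    split=> //; split; first exact: unitarily_equivalent_refl.
    by exists (t^* * t)%g; split=> //; exact: sidem_sinvl.
  by rewrite E => -[_ []].
apply: germ_ext; apply/seteqP; split=> r /= [hr [rpi [f [ff hf rf]]]];
  split=> //; split=> //; exists (e * f)%g; split;
  [exact: sidem_mul|exact: in_hat_mul_sidem| |
   exact: sidem_mul|exact: in_hat_mul_sidem|].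
- by rewrite (sidem_comm ee ff) mulgA rf -!mulgA (sidem_comm ff ee) !mulgA tt'.
- by rewrite (sidem_comm ee ff) mulgA rf -!mulgA (sidem_comm ff ee) !mulgA tt'.
Qed.

Let rep_ex g : exists t,
  over_dom alpha pi t /\ germ_set g = germ_class alpha pi t.
Proof. by have [t ht gt] := germP g; exists t. Qed.

(** A chosen [t] with [g = [t, pi]]; the lemmas below show that nothing
    depends on this choice. *)
Definition germ_source g : S := sval (cid (rep_ex g)).

Lemma germ_source_over g : over_dom alpha pi (germ_source g).
Proof. by rewrite /germ_source; case: cid => t []. Qed.

Lemma germ_sourceK g : germ_of (germ_source_over g) = g.
Proof. by apply: germ_ext;
  rewrite /= [RHS](proj2 (svalP (cid (rep_ex g)))). Qed.

Definition germ_rep g : representation A H :=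
  induced_rep alpha (germ_source g) pi.

Lemma germ_repE t (ht : over_dom alpha pi t) a v :
  germ_rep (germ_of ht) a v = induced_rep alpha t pi a v.
Proof.
have /germ_of_eq[e [ee he te]] := germ_sourceK (germ_of ht).
by apply: (induced_rep_restrict pi_irr _ _ ee he) => //;
  exact: germ_source_over.
Qed.

(** The partial bijection [[t, pi] |-> [s^* t, pi]] of the germs, defined
    where [s^* t] has a germ at [pi]. *)
Definition germ_act s g : option G :=
  if pselect (over_dom alpha pi (s^* * germ_source g)%g) is left h
  then Some (germ_of h) else None.

(** If [t] and [t'] have the same germ at [pi], then [s t'] has a germ at [pi]
    as soon as [s t] does, so that [germ_act] is independent of
    representatives. *)
Lemma over_dom_mul_germ s t t' e : sidem e -> in_hat (pdom (alpha e)) pi ->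
  (t * e = t' * e)%g -> over_dom alpha pi (s * t)%g ->
    over_dom alpha pi (s * t')%g.
Proof.
move=> ee he tt'; rewrite !over_domE => hst.
have [a [x [ea ax]]] := in_hat_mul_sidem pi_irr ee hst he.
exists a, x; split=> //; move: ea; rewrite -mulgA tt' mulgA => /pdomP[b].
by move=> /act_mulP[c ec stc]; move: ec stc => /(act_sidem ee) -> /pdomI.
Qed.

Lemma germ_act_some s t (ht : over_dom alpha pi t)
    (hst : over_dom alpha pi (s^* * t)%g) :
  germ_act s (germ_of ht) = Some (germ_of hst).
Proof.
have /germ_of_eq[e [ee he te]] := germ_sourceK (germ_of ht).
rewrite /germ_act; case: pselect => [h|[]].
  by congr Some; apply/germ_of_eq; exists e; split=> //; rewrite -!mulgA te.
exact: over_dom_mul_germ ee he (esym te) hst.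
Qed.

Lemma germ_act_none s t (ht : over_dom alpha pi t) :
  ~ over_dom alpha pi (s^* * t)%g -> germ_act s (germ_of ht) = None.
Proof.
move=> hst; have /germ_of_eq[e [ee he te]] := germ_sourceK (germ_of ht).
rewrite /germ_act; case: pselect => // h; case: hst.
exact: over_dom_mul_germ ee he te h.
Qed.

Lemma germ_ind (P : G -> Prop) :
  (forall t (ht : over_dom alpha pi t), P (germ_of ht)) -> forall g, P g.
Proof. by move=> Pt g; rewrite -(germ_sourceK g). Qed.

Lemma germ_act_mul s t g :
  germ_act (s * t)%g g = obind (germ_act t) (germ_act s g).
Proof.
elim/germ_ind: g => r hr.
have E : ((s * t)^* * r = t^* * (s^* * r))%g by rewrite sinvM mulgA.
have [hsr|hsr] := pselect (over_dom alpha pi (s^* * r)%g); last first.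
  rewrite (germ_act_none hr hsr) germ_act_none// E over_domE.
  move=> -[a [x [ra ax]]].
  by apply: hsr; rewrite over_domE; exists a, x; split=> //;
    exact: pdom_mulr ra.
rewrite (germ_act_some hr hsr) /=.
have [htr|htr] := pselect (over_dom alpha pi (t^* * (s^* * r))%g); last first.
  by rewrite (germ_act_none hsr htr) germ_act_none// E.
have htr' := htr; rewrite -E in htr'.
rewrite (germ_act_some hr htr') (germ_act_some hsr htr); congr Some.
by apply: germ_ext; rewrite /= E.
Qed.

(** The round trip takes [[r, pi]] to [[s s^* r, pi]], which is the same germ:
    [r] and [s s^* r] agree after multiplication by the idempotent [r^* s s^*
    r]. *)
Lemma germ_act_sinv s g h : germ_act s g = Some h -> germ_act s^*%g h = Some g.
Proof.
elim/germ_ind: g => r hr.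
have [hsr|/(germ_act_none hr)->//] := pselect (over_dom alpha pi (s^* * r)%g).
rewrite (germ_act_some hr hsr) => -[<-].
have hssr : over_dom alpha pi (s^*^* * (s^* * r))%g.
  move: hsr; rewrite !over_domE sinvK => -[a [x [/pdomP[b ab] ax]]].
  exists a, x; split=> //; have [c _ /act_sinvE cb] := act_mulP ab.
  by apply: (@pdomI _ _ _ _ _ _ c); rewrite (act_mulE _ ab).
rewrite (germ_act_some hsr hssr); congr Some; apply/germ_of_eq.
exists (r^* * (s * s^* ) * r)%g; have ss := sidem_sinvr s; split.
- exact: sidem_conj.
- by move: hsr; rewrite /over_dom sinvM sinvK !mulgA.
- have rE := mul_conj_sidem r ss.
  by rewrite sinvK (mulgA s) -(mulgA (s * s^* )%g r) rE mulgA ss.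
Qed.

Lemma germ_act_sinvE s g h :
  germ_act s g = Some h <-> germ_act s^*%g h = Some g.
Proof. by split=> /germ_act_sinv//; rewrite sinvK. Qed.

Lemma germ_act_inj s g h k : germ_act s g = Some k ->
  germ_act s h = Some k -> g = h.
Proof. by move=> /germ_act_sinv gk /germ_act_sinv; rewrite gk => -[]. Qed.

Definition germ_shift s : bop (ell2 G H) := pull_op H (@germ_act_inj s).

Let germ_rep_bound a (g : G) x :
  rnorm (germ_rep g a x) <= 2 * rnorm a * rnorm x.
Proof. exact: rep_bound. Qed.

Let bound_ge0 (a : A) : 0 <= 2 * rnorm a.
Proof. by rewrite mulr_ge0 ?rnorm_ge0. Qed.

Definition germ_diag a : bop (ell2 G H) :=
  diag_op (T := fun g => germ_rep g a) (bound_ge0 a) (germ_rep_bound a).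

Definition germ_diag_rep : representation A (ell2 G H).
Proof.
apply: (@Representation R A _ germ_diag) => [c a b x|a b x|a].
- by apply: ell2_eqP => g; exact: rep_linear.
- by apply: ell2_eqP => g; exact: rep_amul.
- apply: adjoint_delta => xi g v.
  by rewrite inner_delta /germ_diag diag_op_delta inner_delta; exact: rep_astar.
Defined.

Lemma germ_diag_repE a xi g : germ_diag_rep a xi g = germ_rep g a (xi g).
Proof. by []. Qed.

Lemma germ_diag_rep_delta a g v :
  germ_diag_rep a (ell2_delta g v) = ell2_delta g (germ_rep g a v).
Proof. exact: diag_op_delta. Qed.

Lemma germ_shiftE s xi g : germ_shift s xi g = oapp xi 0 (germ_act s g).
Proof. by []. Qed.

(** At a germ [[t, pi]] which [s^*] moves, this is the pointwise covariance
    relation. At the others the right side vanishes, and so does [beta_t(pi)]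
    on the range of [alpha_s]. *)
Lemma germ_shift_conj s a b x : alpha s a = Some b ->
  germ_diag_rep b x = germ_shift s (germ_diag_rep a (germ_shift s^*%g x)).
Proof.
move=> sab; apply: ell2_eqP; elim/germ_ind => t ht.
rewrite germ_diag_repE germ_shiftE germ_repE.
have [hst|hst] := pselect (over_dom alpha pi (s^* * t)%g).
  have gs := germ_act_some ht hst; rewrite gs.
  rewrite -[oapp _ _ _]/(germ_diag_rep a (germ_shift s^*%g x) (germ_of hst)).
  rewrite germ_diag_repE germ_shiftE (germ_act_sinv gs) germ_repE.
  exact: induced_rep_mul.
rewrite (germ_act_none ht hst) /=; apply: contra_notP hst => /eqP bx.
apply/(in_hat_induced pi_irr _ ht); exists b, (x (germ_of ht)); split=> //.
exact: pdomI (act_sinv sab).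
Qed.

(** Vectors concentrated at a single germ factor exactly, because [rho_pi]
    acts diagonally and every vector is [pi(b) w] with [b] in the domain of
    [alpha_(s t)]. These vectors give both the non-degeneracy of [rho_pi] and
    the inclusion of the range of [sigma_e] in [rho_pi(A_e) H]. *)
Lemma delta_in_range s t (ht : over_dom alpha pi t) v :
  over_dom alpha pi (s * t)%g -> exists a w, pdom (alpha s) a /\
  ell2_delta (germ_of ht) v = germ_diag_rep a (ell2_delta (germ_of ht) w).
Proof.
rewrite over_domE => /(factor_over pi_irr v).
move=> [b [w [/pdomP[c /act_mulP[a tb sa]] ->]]].
exists a, w; split; first exact: pdomI sa.
by rewrite germ_diag_rep_delta germ_repE (induced_rep_ext pi_irr _ ht tb).
Qed.

End Germs.

(* The two formulas determine rho and sigma, since the germs [germ_of ht]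
   exhaust [germ alpha pi]. *)
Theorem theorem3p5 (S : invSemigroupType) (R : realType) (A : cstarType R)
    (alpha : action S A) (H : hilbertType R) (pi : representation A H)
    (pi_irr : irreducible_rep pi) :
  exists (rho : representation A (ell2 (germ alpha pi) H))
         (sigma : S -> bop (ell2 (germ alpha pi) H)),
    [/\ forall (a : A) (xi : ell2 (germ alpha pi) H) (t : S)
           (ht : over_dom alpha pi t),
           rho a xi (germ_of ht) = induced_rep alpha t pi a (xi (germ_of ht)),
        forall (s : S) (xi : ell2 (germ alpha pi) H) (t : S)
           (ht : over_dom alpha pi t),
           (in_hat (pdom (alpha (s * s^*)%g)) (induced_rep alpha t pi) ->
              exists hst : over_dom alpha pi (s^* * t)%g,
                sigma s xi (germ_of ht) = xi (germ_of hst)) /\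
           (~ in_hat (pdom (alpha (s * s^*)%g)) (induced_rep alpha t pi) ->
              sigma s xi (germ_of ht) = 0)
      & covariant_rep alpha rho sigma].
Proof.
exists (germ_diag_rep alpha pi), (germ_shift alpha pi_irr);
  split=> [a xi t ht|s xi t ht|].
- by rewrite germ_diag_repE germ_repE.
- rewrite pdom_range (in_hat_induced pi_irr _ ht) germ_shiftE.
  split=> [hst|hst]; last by rewrite (germ_act_none pi_irr ht hst).
  by exists hst; rewrite (germ_act_some pi_irr ht hst).
split=> [|s t x|s|s a b sab x|e ee].
- apply/seteqP; split=> // xi _; apply: ell2_closure_span;
    elim/germ_ind => t ht.
  have ht' : over_dom alpha pi (t^* * t)%g 
    by rewrite over_domE pdom_source -over_domE.
  have [a [w [_ aw]]] := delta_in_range pi_irr ht (xi (germ_of ht)) ht'.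
  by exists a, (ell2_delta (germ_of ht) w).
- apply: ell2_eqP => g; rewrite !germ_shiftE germ_act_mul//.
  by case: (germ_act s g).
- apply: pull_op_adjoint => g h; by rewrite germ_act_sinvE// sinvK.
- exact: germ_shift_conj.
- apply/seteqP; split=> [_ [a [x [ea ->]]]|_ [z _ <-]].
    have sab := pdom_sidemE ee ea.
    by rewrite (germ_shift_conj pi_irr x sab); eexists.
  apply: closed_span_factorization; [exact: act_ideal|exact: pdom_astar|].
  apply: ell2_closure_span; elim/germ_ind => t ht; rewrite germ_shiftE.
  have [hst|hst] := pselect (over_dom alpha pi (e^* * t)%g).
    rewrite (sidem_sinv ee) in hst.
    have [a [w [ea aw]]] :=
      delta_in_range pi_irr ht (oapp z 0 (germ_act e (germ_of ht))) hst.
    by exists a, (ell2_delta (germ_of ht) w).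
  rewrite (germ_act_none pi_irr ht hst); exists 0, 0; split.
    exact: ideal0 (act_ideal alpha e).
  by rewrite rep0; apply: ell2_eqP => g /=; case: eqP.
Qed.
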